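(* Let $k\ge2$, $d\ge0$, and let $X$ be any $\mathbb{Z}_k$-equivariant subdivision of the simplicial complex $(\mathbb{Z}_k)^{*(d+2)}$. There are a subcomplex $Y$ of $X$, homeomorphic to a $(d+1)$-sphere, and a generalized $(d+1)$-sphere $(x_i)_{0\le i\le d+1}$ in $C_\bullet(X;\mathbb{Z})$ with $x_{d+1}\in C_{d+1}(Y;\mathbb{Z})$, such that for every admissible equivariant $\mathbb{Z}_k\times\mathbb{N}$-labelling $\ell$ of $X$, the number of $(d+1)$-simplices of $Y$ to which $\ell$ assigns strongly alternating patterns, counted as $$\alpha_{d+1}:=u\big(\sigma\cdot f_{d+1}(h^\ell_{d+1}(x_{d+1}))\big)\in\mathbb{Z},$$ is congruent to $1$ modulo $k$.
   Context: $\mathbb{Z}_k=\{e,g,\dots,g^{k-1}\}$ is the cyclic group of order $k$, written multiplicatively, with generator $g$; $\mathbb{N}$ is the set of positive integers; $\Lambda=\mathbb{Z}[\mathbb{Z}_k]$. Set $\tau=g-e$, $\sigma=e+g+\cdots+g^{k-1}$, and $\sigma_i=e+g+\cdots+g^{i-1}$ for $0\le i\le k$. The map $u\colon\Lambda\to\mathbb{Z}$ takes the coefficient of $e$. The join $(\mathbb{Z}_k)^{*m}$ is the simplicial complex with vertex set $\mathbb{Z}_k\times\{1,\dots,m\}$ whose simplices are the sets of vertices containing at most one vertex from each copy $\mathbb{Z}_k\times\{j\}$, with the free diagonal $\mathbb{Z}_k$-action $h(s,j)=(hs,j)$. A $\mathbb{Z}_k$-equivariant subdivision is a subdivision on which the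 induced action is simplicial. A labelling is a map $\ell\colon V(X)\to\mathbb{Z}_k\times\mathbb{N}$, $\ell(v)=(s,c)$ with sign $s$ and color $c$. It is admissible if the two vertices of any edge carry different colors or the same sign, and equivariant if $\ell(hv)=h\,\ell(v)$ for all $h\in\mathbb{Z}_k$ and vertices $v$, where $h(s,c)=(hs,c)$. Generalized $r$-sphere in $C_\bullet(X;\mathbb{Z})$: a sequence of chains $x_i\in C_i(X;\mathbb{Z})$, $0\le i\le r$, such that for all $0<i\le r$: $\partial x_i=\sigma x_{i-1}$ if $i$ is even and $\partial x_i=\tau x_{i-1}$ if $i$ is odd. $S_r$ is the free abelian group with basis the symbols $h_0\otimes\cdots\otimes h_r$, $h_i\in\mathbb{Z}_k$, with $\Lambda$-module structure $h\cdot(h_0\otimes\cdots\otimes h_r)=hh_0\otimes\cdots\otimes hh_r$ and $\Lambda$-basis $[h_1|\cdots|h_r]:=e\otimes h_1\otimes h_1h_2\otimes\cdots\otimes h_1\cdots h_r$. $h_r^\ell\colon C_r(X;\mathbb{Z})\to S_r$ is the linear map sending an oriented simplex $\langle v_0,\dots,v_r\rangle$ with $\ell(v_i)=(s_i,c_i)$ to $\operatorname{sign}(\pi)\,s_{\pi(0)}\otimes\cdots\otimes s_{\pi(r)}$ if the $c_i$ are pairwise distinct, where $\pi$ is the permutation of $\{0,\dots,r\}$ with $c_{\pi(0)}<\cdots<c_{\pi(r)}$, and to $0$ otherwise; $s_{\pi(0)}\otimes\cdots\otimes s_{\pi(r)}$ is the pattern assigned to the simplex. An element $h_0\otimes\cdots\otimes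 h_{2s}=g^{a_0}[g^{a_1}|\cdots|g^{a_{2s}}]$ with $0\le a_i<k$ is strongly alternating if $a_{2i+1}+a_{2i+2}\ge k$ for all $0\le i\le s-1$. An element $h_0\otimes\cdots\otimes h_{2s+1}$ is strongly alternating if there is $a\in\mathbb{Z}_k$ such that $a\otimes h_0\otimes\cdots\otimes h_{2s+1}$ is strongly alternating. $f_r\colon S_r\to\Lambda$ is the $\Lambda$-linear map with $f_{2s}([h_1|\cdots|h_{2s}])=e$ if $[h_1|\cdots|h_{2s}]$ is strongly alternating and $0$ otherwise, and $f_{2s+1}([h_1|\cdots|h_{2s+1}])=\sigma_i\,f_{2s}([h_2|\cdots|h_{2s+1}])$ for $h_1=g^i$, $0\le i<k$. *)

(* Defs.v *)
From HB Require Import structures.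
From mathcomp Require Import all_boot all_order all_algebra all_fingroup.
From mathcomp Require Import all_classical all_reals topology normedtype.

Set Implicit Arguments.
Unset Strict Implicit.
Unset Printing Implicit Defensive.

Import Order.TTheory GRing.Theory Num.Theory.
Import numFieldNormedType.Exports.
Local Open Scope ring_scope.

(** * The cyclic group and its group ring

  The cyclic group is ['Z_k], written multiplicatively through its
  [finGroupType] structure ([%g]); ['Z_k] has [k] elements only if [1 < k].
  The natural number underlying [h : 'Z_k] is the exponent [0 <= a < k] with
  [h = g ^ a], see [gen_expg]. *)

Definition gen (k : nat) : 'Z_k := Zp1.

Lemma gen_expg (k : nat) (h : 'Z_k) : (gen k ^+ (h : nat))%g = h.
Proof. by rewrite Zp_expg mul1n valZpK. Qed.

(* [Lambda k] is kept distinct from [{ffun 'Z_k -> int}], whose multiplication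
   is pointwise: the product of [Lambda k] is the convolution. *)
Definition Lambda (k : nat) : Type := {ffun 'Z_k -> int}.

HB.instance Definition _ (k : nat) :=
  GRing.Zmodule.copy (Lambda k) {ffun 'Z_k -> int}.

Section GroupRing.
Variable k : nat.
Implicit Types (a b c : Lambda k) (h x y : 'Z_k).

Definition gelt h : Lambda k := [ffun x => (x == h)%:R].

Definition convol a b : Lambda k :=
  [ffun h : 'Z_k => \sum_(x : 'Z_k) a x * b (x^-1 * h)%g].

Fact convolA : associative convol.
Proof.
move=> a b c; apply/ffunP => h; rewrite !ffunE.
under [RHS]eq_bigr => x _ do rewrite ffunE mulr_suml.
rewrite exchange_big /=; apply: eq_bigr => y _; rewrite ffunE mulr_sumr.
rewrite (reindex_inj (mulgI (y^-1)%g)) /=; apply: eq_bigr => x _.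
by rewrite mulrA invMg invgK -!mulgA mulKVg.
Qed.

Fact convolC : commutative convol.
Proof.
move=> a b; apply/ffunP => h; rewrite !ffunE.
rewrite (reindex_inj (inj_comp (mulgI h) (@invg_inj _))) /=.
apply: eq_bigr => x _; rewrite mulrC invMg invgK mulgKV.
by rewrite -[(h * _)%g]/(_ + _) addrC.
Qed.

Fact convol1 : left_id (gelt 1%g) convol.
Proof.
move=> a; apply/ffunP => h; rewrite ffunE (bigD1 (1%g : 'Z_k)) //= ffunE eqxx.
rewrite mul1r invg1 mul1g big1 ?addr0 // => x /negPf nx1.
by rewrite ffunE nx1 mul0r.
Qed.

Fact convolDl : left_distributive convol +%R.
Proof.
move=> a b c; apply/ffunP => h; rewrite !ffunE -big_split /=.
by apply: eq_bigr => x _; rewrite ffunE mulrDl.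
Qed.

Fact gelt1_neq0 : gelt 1%g != 0.
Proof. by apply/eqP => /ffunP/(_ 1%g); rewrite !ffunE eqxx. Qed.

End GroupRing.

HB.instance Definition _ (k : nat) := GRing.Zmodule_isComNzRing.Build (Lambda k)
  (@convolA k) (@convolC k) (@convol1 k) (@convolDl k) (@gelt1_neq0 k).

Definition tau (k : nat) : Lambda k := gelt (gen k) - 1.

Definition sigma_ (k i : nat) : Lambda k := \sum_(j < i) gelt (gen k ^+ j)%g.

Definition sigma (k : nat) : Lambda k := sigma_ k k.

Definition ucoef (k : nat) (a : Lambda k) : int := a 1%g.

(* The [Lambda]-module structure on the free abelian group [{ffun T -> int}]
   induced by an action of [Z_k] on [T]. *)
Definition lact (k : nat) (T : finType) (act : 'Z_k -> T -> T)
    (a : Lambda k) (c : {ffun T -> int}) : {ffun T -> int} :=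
  [ffun t => \sum_(h : 'Z_k) a h * c (act h^-1%g t)].

(* The diagonal action on tuples. *)
Definition tact (k : nat) (V : Type) (n : nat) (act : 'Z_k -> V -> V)
    (h : 'Z_k) (t : n.-tuple V) : n.-tuple V := [tuple of map (act h) t].

(** * The modules [S_r] and the maps [f_r] *)

(* The basis symbol [h_0 (x) ... (x) h_r] is the tuple of its factors. *)
Definition Sr (k r : nat) : Type := {ffun r.+1.-tuple 'Z_k -> int}.

HB.instance Definition _ (k r : nat) :=
  GRing.Zmodule.copy (Sr k r) {ffun r.+1.-tuple 'Z_k -> int}.

Definition symb (k r : nat) (t : r.+1.-tuple 'Z_k) : Sr k r :=
  [ffun w => (w == t)%:R].

(* [h_0 (x) ... (x) h_r = h_0 [h_0^-1 h_1 | ... | h_(r-1)^-1 h_r]]; the bar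
   element on the right is represented by the sequence of its entries. *)
Definition bar (k r : nat) (t : r.+1.-tuple 'Z_k) : seq 'Z_k :=
  pairmap (fun x y : 'Z_k => (x^-1 * y)%g) (thead t) (behead t).

(* Strong alternation of [g^a_0 [g^a_1 | ... | g^a_2s]], which does not depend
   on [a_0]: in terms of the sequence [b] of bar entries, [a_(2i+1)] and
   [a_(2i+2)] are the exponents of entries number [2i] and [2i+1]. *)
Definition strongly_alternating (k : nat) (b : seq 'Z_k) : bool :=
  [forall i : 'I_(size b)./2,
     (k <= (nth 1%g b i.*2 : nat) + (nth 1%g b i.*2.+1 : nat))%N].

Definition fbar_even (k : nat) (b : seq 'Z_k) : Lambda k :=
  if strongly_alternating b then 1 else 0.

Definition fbar (k : nat) (b : seq 'Z_k) : Lambda k :=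
  if odd (size b) then sigma_ k (head 1%g b : 'Z_k) * fbar_even (behead b)
  else fbar_even b.

Definition fr (k r : nat) (c : Sr k r) : Lambda k :=
  \sum_(t : r.+1.-tuple 'Z_k) (gelt (thead t) * fbar (bar t)) *~ c t.

Section FLinear.
Variables k r : nat.

Lemma geltM (x y : 'Z_k) : gelt (x * y)%g = gelt x * gelt y :> Lambda k.
Proof.
apply/ffunP => h; rewrite [RHS]ffunE (bigD1 x) //= big1 => [|z /negPf nzx].
  rewrite !ffunE eqxx mul1r addr0; congr (nat_of_bool _)%:R.
  by apply/eqP/eqP => [->|<-]; rewrite ?mulKg ?mulKVg.
by rewrite ffunE nzx mul0r.
Qed.

Lemma Lambda_sum_gelt (a : Lambda k) : a = \sum_(h : 'Z_k) gelt h *~ a h.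
Proof.
apply/ffunP => x; rewrite sum_ffunE (bigD1 x) //= big1 => [|h /negPf nhx].
  by rewrite addr0 ffunMzE ffunE eqxx intz.
by rewrite ffunMzE ffunE eq_sym nhx mul0rz.
Qed.

Let sact : 'Z_k -> r.+1.-tuple 'Z_k -> r.+1.-tuple 'Z_k :=
  tact (fun h x : 'Z_k => (h * x)%g).

Lemma bar_sact h t : bar (sact h t) = bar t.
Proof.
case: t => -[|x s] //= st; rewrite /bar /thead !(tnth_nth 1%g) /=.
elim: s x {st} => //= y s IHs x; rewrite IHs.
by rewrite invMg -mulgA mulKg.
Qed.

Lemma fr_linear (a : Lambda k) (c : Sr k r) : fr (lact sact a c) = a * fr c.
Proof.
rewrite [in RHS](Lambda_sum_gelt a) mulr_suml /fr.
under eq_bigr => t _ do rewrite ffunE mulrz_sumr.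
rewrite exchange_big /=; apply: eq_bigr => h _.
rewrite mulr_sumr (reindex_inj (h := sact h)); last first.
  apply: (can_inj (g := sact h^-1%g)) => t.
  by apply: eq_from_tnth => i; rewrite !tnth_map mulKg.
apply: eq_bigr => t _; rewrite bar_sact.
have -> : sact h^-1%g (sact h t) = t.
  by apply: eq_from_tnth => i; rewrite !tnth_map mulKg.
have -> : thead (sact h t) = (h * thead t)%g by rewrite /thead tnth_map.
by rewrite geltM mulrzAl mulrzAr -mulrzA mulrA [c t * a h]mulrC.
Qed.

End FLinear.

(** * Simplicial complexes and subdivisions *)

(* Finite abstract simplicial complexes, given by their nonempty simplices. *)
Definition simplicial_complex (V : finType) (X : {set {set V}}) : Prop :=
  finset.set0 \notin X /\
  forall A B : {set V}, A \in X -> B \subset A -> B != finset.set0 -> B \in X.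

Definition subcomplex (V : finType) (Y X : {set {set V}}) : Prop :=
  simplicial_complex Y /\ Y \subset X.

Section Geometry.
Variables (R : realType) (E : lmodType R) (V : finType) (pos : V -> E).
Local Open Scope classical_set_scope.

Definition hull (A : {set V}) : set E :=
  [set x | exists w : V -> R, [/\ forall v, v \in A -> 0 <= w v,
     \sum_(v in A) w v = 1 & x = \sum_(v in A) w v *: pos v]].

Definition affinely_independent (A : {set V}) : Prop :=
  forall w : V -> R, \sum_(v in A) w v = 0 ->
    \sum_(v in A) w v *: pos v = 0 -> forall v, v \in A -> w v = 0.

Definition polyhedron (X : {set {set V}}) : set E :=
  \bigcup_(A in [set A | A \in X]) hull A.

(* The last clause covers disjoint simplices as well, as [hull set0] is
   empty; in particular it forces [pos] to be injective. *)
Definition geometric_complex (X : {set {set V}}) : Prop :=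
  [/\ simplicial_complex X,
      forall v : V, [set v]%SET \in X,
      forall A, A \in X -> affinely_independent A &
      forall A B, A \in X -> B \in X ->
        hull A `&` hull B = hull (A :&: B)%SET].

End Geometry.

Definition subdivision (R : realType) (E : lmodType R) (V W : finType)
    (pos : V -> E) (X : {set {set V}}) (posK : W -> E) (K : {set {set W}}) :
    Prop :=
  [/\ geometric_complex pos X,
      forall A, A \in X ->
        exists2 B, B \in K & (hull pos A `<=` hull posK B)%classic &
      polyhedron pos X = polyhedron posK K].

(* The [m]-fold join of [Z_k]; the index [j : 'I_m] runs from [0]. *)
Definition join_complex (k m : nat) : {set {set 'Z_k * 'I_m}} :=
  [set A : {set 'Z_k * 'I_m} | (A != finset.set0) &&
     [forall p in A, forall q in A, (p.2 == q.2) ==> (p == q)]].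

(* The standard geometric realization of the join in the space
   ['M_((Zp_trunc k).+2, m)] of functions ['Z_k * 'I_m -> R]: the vertex [(s, j)]
   is the corresponding unit vector. *)
Definition join_vertex (R : realType) (k m : nat) (p : 'Z_k * 'I_m) :
  'M[R]_((Zp_trunc k).+2, m) := delta_mx p.1 p.2.

(* The linear extension of the diagonal action [h (s, j) = (h s, j)]. *)
Definition join_act (R : realType) (k m : nat) (h : 'Z_k)
    (x : 'M[R]_((Zp_trunc k).+2, m)) : 'M[R]_((Zp_trunc k).+2, m) :=
  \matrix_(s, j) x (h^-1 * s : 'Z_k)%g j.

Lemma join_act_vertex (R : realType) (k m : nat) (h s : 'Z_k) (j : 'I_m) :
  join_act h (join_vertex R (s, j)) = join_vertex R ((h * s)%g, j).
Proof.
apply/matrixP => t i; rewrite !mxE /=; congr (nat_of_bool (_ && _))%:R.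
by apply/eqP/eqP => [<-|->]; rewrite ?mulKg ?mulKVg.
Qed.

(* A subdivision on whose simplices the action of [Z_k] on the polyhedron of the
   join is simplicial; [act] is the induced action on the vertices, and is
   determined by [pos], which is injective. *)
Record equivariant_subdivision (R : realType) (k m : nat) := EquivSubdivision {
  vert : finType;
  pos : vert -> 'M[R]_((Zp_trunc k).+2, m);
  simp : {set {set vert}};
  act : 'Z_k -> vert -> vert;
  simpP : subdivision pos simp (@join_vertex R k m) (join_complex k m);
  actP : forall h v, pos (act h v) = join_act h (pos v);
  act_simp : forall h A, A \in simp -> act h @: A \in simp
}.

Definition sphere (R : realType) (n : nat) : set 'rV[R]_n.+1 :=
  [set x | \sum_i x 0 i ^+ 2 = 1]%classic.
Arguments sphere R n : clear implicits.

Definition homeomorphic (T U : topologicalType) (A : set T) (B : set U) : Prop :=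
  exists (F : T -> U) (G : U -> T),
    [/\ {within A, continuous F}%classic, {within B, continuous G}%classic,
        forall x, A x -> B (F x) /\ G (F x) = x &
        forall y, B y -> A (G y) /\ F (G y) = y].

(** * Simplicial chains *)

Section Chains.
Variables (V : finType).

(* An oriented simplex [<v_0, ..., v_r>] is given by the tuple of its vertices,
   and a chain by its coefficient at each oriented simplex. *)
Definition chain (r : nat) : Type := {ffun r.+1.-tuple V -> int}.

HB.instance Definition _ (r : nat) :=
  GRing.Zmodule.copy (chain r) {ffun r.+1.-tuple V -> int}.

Definition permute (r : nat) (p : 'S_r.+1) (t : r.+1.-tuple V) :
  r.+1.-tuple V := [tuple tnth t (p i) | i < r.+1].

(* [C_r(X; Z)]: a change of orientation changes the sign of the coefficient. *)
Definition in_chains (X : {set {set V}}) (r : nat) (c : chain r) : Prop :=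
  (forall (p : 'S_r.+1) t, c (permute p t) = (-1) ^+ p * c t) /\
  (forall t : r.+1.-tuple V, c t != 0 -> uniq t /\ [set v in t] \in X).

(* The elementary chain of an oriented simplex. *)
Definition osimplex (r : nat) (t : r.+1.-tuple V) : chain r :=
  [ffun w => \sum_(p : 'S_r.+1 | permute p t == w) (-1) ^+ p].

(* Linear extension of a map [F] defined on oriented simplices: each simplex is
   taken once, oriented by the enumeration of [V]; as the coefficients of a
   chain are alternating, any other orientation gives the same result when [F]
   is alternating. *)
Definition lin_ext (M : zmodType) (r : nat) (F : r.+1.-tuple V -> M)
    (c : chain r) : M :=
  \sum_(t : r.+1.-tuple V | sorted ltn [seq (enum_rank v : nat) | v <- t])
     F t *~ c t.

Definition face (r : nat) (i : 'I_r.+2) (t : r.+2.-tuple V) : r.+1.-tuple V :=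
  [tuple tnth t (lift i j) | j < r.+1].

Definition boundary (r : nat) : chain r.+1 -> chain r :=
  lin_ext (fun t => \sum_(i < r.+2) osimplex (face i t) *~ (-1) ^+ i).

End Chains.

Section Labellings.
Variables (R : realType) (k m : nat) (X : equivariant_subdivision R k m).

Definition chain_act (r : nat) (a : Lambda k) (c : chain (vert X) r) :
  chain (vert X) r := lact (tact (@act _ _ _ X)) a c.

(* Only the [x i] with [i <= r] matter. *)
Definition generalized_sphere (r : nat) (x : forall i, chain (vert X) i) :
    Prop :=
  (forall i, (i <= r)%N -> in_chains (simp X) (x i)) /\
  (forall i, (i < r)%N ->
     boundary (x i.+1) = chain_act (if odd i.+1 then tau k else sigma k) (x i)).

Variable l : vert X -> 'Z_k * nat.

Definition positive_colors : Prop := forall v, (0 < (l v).2)%N.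

Definition admissible : Prop := forall v w : vert X,
  v != w -> [set v; w] \in simp X -> (l v).2 <> (l w).2 \/ (l v).1 = (l w).1.

Definition equivariant : Prop := forall (h : 'Z_k) (v : vert X),
  l (act h v) = ((h * (l v).1)%g, (l v).2).

(* The value of [h_r^l] at an oriented simplex: the sum has exactly one term if
   the colors are pairwise distinct, and none otherwise. *)
Definition pattern (r : nat) (t : r.+1.-tuple (vert X)) : Sr k r :=
  \sum_(p : 'S_r.+1 | sorted ltn [seq (l v).2 | v <- permute p t])
     symb (map_tuple (fun v => (l v).1) (permute p t)) *~ (-1) ^+ p.

Definition hl (r : nat) : chain (vert X) r -> Sr k r := lin_ext (@pattern r).

Definition alpha (r : nat) (c : chain (vert X) r) : int :=
  ucoef (sigma k * fr (hl c)).

End Labellings.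

(* Main.v *)
Require Import Defs.
From mathcomp Require Import all_boot all_order all_algebra all_fingroup.
From mathcomp Require Import all_classical all_reals topology normedtype.
From mathcomp Require Import trigo realfun zify ring lra.

Set Implicit Arguments.
Unset Strict Implicit.
Unset Printing Implicit Defensive.

Import Order.TTheory GRing.Theory Num.Theory.
Import numFieldNormedType.Exports.
Local Open Scope ring_scope.
Local Notation act := Defs.act.

(** * Why the count is one modulo [k]

  Write [y_i] for the image of [x_i] under [h_i^l] followed by [f_i].  The maps
  [f_i] form a chain map from the bar resolution to the periodic resolution

    ... --tau--> Lambda --sigma--> Lambda --tau--> Lambda

  and, for an admissible labelling, the maps [h_i^l] form a chain map to the
  bar resolution; both are equivariant.  The equations of a generalized sphere
  therefore become [c * y_(i+1) = c * y_i], where [c] is [tau] or [sigma].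
  An element killed by [sigma] has augmentation zero, and one killed by [tau]
  is an integer multiple of [sigma], whose augmentation is [k].  So modulo [k]
  the augmentation of [y_i] does not depend on [i].  In degree zero it is one
  if [x_0] is a vertex, and in degree [d + 1] it is the number [alpha]
  ([alpha_generalized_sphere]).  That [f] is a chain map ([alt_fsymb]) comes
  from an interpretation of strong alternation: it is a cup power of the
  two-cocycle that records the carries in the addition of exponents modulo [k].

  A generalized sphere exists in the join itself: [x_0] is a vertex of the
  first copy of [Z_k], and [x_(i+1)] is the cone over [tau x_i] or [sigma x_i]
  whose apex is a vertex of the next copy ([model_pairing_alt]).  Two
  consecutive copies of [Z_k] only contribute the edges of a cycle of length
  [2k], so that the last chain is supported in a join of such cycles and, if
  the number of copies is odd, of a pair of points.

  It is transported to [X] by the subdivision operator.  A simplex of [X]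
  inside a simplex [T] of the join of the same dimension gets the sign of the
  determinant of its barycentric coordinates.  This commutes with boundaries
  ([subdiv_boundary]) because a simplex of codimension one has exactly one
  neighbour on each side of it inside [T]: there are two, with opposite signs,
  in the interior of [T], and there is one at a facet.

  The subcomplex [Y] consists of the simplices of [X] over the join of cycles.
  Its polyhedron is a sphere: the cone over a cycle of length [2k] is the fan
  of a regular polygon, that is a plane, so the cone over the join of cycles
  is mapped bijectively to a Euclidean space by a linear map, and a radial
  projection does the rest ([model_sphere_homeomorphic]). *)

(** * The group ring and the bar symbols *)

(** The alternating sum of the values of [G] at the faces of [s].  The recursion
  makes the boundary of a cone a matter of computation; [altE] is the usual
  formula. *)
Fixpoint alt (T : Type) (M : zmodType) (G : seq T -> M) (s : seq T) : M :=
  if s is x :: s' then G s' - alt (fun w => G (x :: w)) s' else 0.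

(** The differential of the periodic resolution from degree [n] to [n.-1]. *)
Definition resolution_coef (k n : nat) : Lambda k := if odd n then tau k else sigma k.

Definition augmentation (k : nat) (a : Lambda k) : int := \sum_h a h.

Section Alt.
Variables (T : Type) (M : zmodType).
Implicit Types (G : seq T -> M) (s : seq T).

Lemma eq_alt_size G G' s :
  (forall w, (size w).+1 = size s -> G w = G' w) -> alt G s = alt G' s.
Proof.
elim: s G G' => //= x s IHs G G' eqG; rewrite eqG //.
by rewrite (IHs _ (fun w => G' (x :: w))) // => w sw; apply: eqG; rewrite /= sw.
Qed.

Lemma eq_alt G G' s : G =1 G' -> alt G s = alt G' s.
Proof. by move=> eqG; apply: eq_alt_size => w _. Qed.

Lemma alt_map (U : Type) (f : U -> T) G (s : seq U) :
  alt G (map f s) = alt (fun w => G (map f w)) s.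
Proof. by elim: s G => //= x s IHs G; rewrite IHs. Qed.

Lemma alt_mulz (a : M) (G : seq T -> int) s :
  alt (fun w => a *~ G w) s = a *~ alt G s.
Proof. by elim: s G => [|x s IHs] G //=; rewrite IHs mulrzBr. Qed.

End Alt.

Section GroupRingFacts.
Variable k : nat.
Hypothesis k_ge2 : (2 <= k)%N.
Implicit Types (x y z h : 'Z_k) (a b : Lambda k).

Lemma gelt1 : gelt 1%g = 1 :> Lambda k. Proof. by []. Qed.

Lemma sigma_D i j :
  sigma_ k (i + j) = sigma_ k i + gelt (gen k ^+ i)%g * sigma_ k j.
Proof.
rewrite /sigma_ big_split_ord /=; congr (_ + _); rewrite mulr_sumr.
by apply: eq_bigr => l _; rewrite expgD geltM.
Qed.

Lemma tau_sigma_ i : tau k * sigma_ k i = gelt (gen k ^+ i)%g - 1.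
Proof.
elim: i => [|i IHi]; first by rewrite /sigma_ big_ord0 mulr0 expg0 gelt1 subrr.
rewrite -addn1 sigma_D mulrDr IHi expgD geltM.
have -> : sigma_ k 1 = 1 by rewrite /sigma_ big_ord1 expg0.
by rewrite /tau mulr1 mulrBl mul1r mulrC expg1; ring.
Qed.

Lemma sigmaE : sigma k = \sum_(h : 'Z_k) gelt h.
Proof.
rewrite /sigma /sigma_ -(big_mkord xpredT (fun j => gelt (gen k ^+ j)%g)).
rewrite -[X in index_iota _ X](Zp_cast k_ge2) big_mkord.
by apply: eq_bigr => h _; rewrite gen_expg.
Qed.

Lemma gelt_sigma x : gelt x * sigma k = sigma k.
Proof.
rewrite sigmaE mulr_sumr [RHS](reindex_inj (mulgI x)) /=.
by apply: eq_bigr => h _; rewrite geltM.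
Qed.

(** Only the augmentation survives, because every group element fixes [sigma]. *)
Lemma sigma_mul a : sigma k * a = sigma k *~ augmentation a.
Proof.
rewrite {1}(Lambda_sum_gelt a) mulr_sumr /augmentation mulrz_sumr.
by apply: eq_bigr => h _; rewrite mulrzAr mulrC gelt_sigma.
Qed.

Lemma ucoef_sigma_mul a : ucoef (sigma k * a) = augmentation a.
Proof.
rewrite sigma_mul sigmaE /ucoef ffunMzE sum_ffunE (bigD1 (1%g : 'Z_k)) //=.
rewrite big1 ?addr0 ?ffunE ?eqxx ?intz // => h /negPf nh1.
by rewrite ffunE eq_sym nh1.
Qed.

Lemma tau_sigma : tau k * sigma k = 0.
Proof. by rewrite /tau mulrBl gelt_sigma mul1r subrr. Qed.

Lemma augmentationD a b : augmentation (a + b) = augmentation a + augmentation b.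
Proof. by rewrite /augmentation -big_split; apply: eq_bigr => h _; rewrite ffunE. Qed.

Lemma augmentation_gelt x : augmentation (gelt x) = 1.
Proof.
rewrite /augmentation (bigD1 x) //= ffunE eqxx big1 ?addr0 // => h /negPf nhx.
by rewrite ffunE nhx.
Qed.

(** The walk from [x] to [y] along the cycle [e], [g], [g ^ 2], and so on; the
  element [x * g ^ j] stands for the step that starts there. *)
Definition path_elt x y : Lambda k := gelt x * sigma_ k (x^-1 * y : 'Z_k)%g.

(** The carry in the addition modulo [k] of the exponents of [x^-1 * y] and
  [y^-1 * z]. *)
Definition carry x y z : int :=
  (k <= ((x^-1 * y : 'Z_k)%g : nat) + ((y^-1 * z : 'Z_k)%g : nat))%N%:R.

Lemma tau_path x y : tau k * path_elt x y = gelt y - gelt x.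
Proof.
by rewrite /path_elt mulrCA tau_sigma_ gen_expg mulrBr mulr1 -geltM mulKVg.
Qed.

(** The walk from [x] to [z] through [y] winds around the cycle once more than
  the direct one exactly if the exponents carry. *)
Lemma path_carry x y z :
  path_elt y z - path_elt x z + path_elt x y = sigma k *~ carry x y z.
Proof.
suff E : path_elt y z + path_elt x y = path_elt x z + sigma k *~ carry x y z.
  by rewrite addrAC E addrC addKr.
rewrite /path_elt /carry.
have -> : (x^-1 * z = (x^-1 * y) * (y^-1 * z) :> 'Z_k)%g by rewrite mulgA mulgK.
have -> : gelt y = gelt x * gelt (x^-1 * y)%g :> Lambda k by rewrite -geltM mulKVg.
move: (x^-1 * y)%g (y^-1 * z)%g => a b.
rewrite -(gelt_sigma x) -mulrA -mulrDr -mulrzAr -mulrDr; congr (_ * _).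
rewrite addrC -{2}(gen_expg a) -sigma_D.
have vab : ((a * b)%g : 'Z_k) = ((a + b) %% k)%N :> nat.
  by rewrite /= [X in (_ %% X)%N](Zp_cast k_ge2).
rewrite vab.
have la : (a < k)%N by rewrite -[X in (_ < X)%N](Zp_cast k_ge2) ltn_ord.
have lb : (b < k)%N by rewrite -[X in (_ < X)%N](Zp_cast k_ge2) ltn_ord.
case: leqP => [kab|kab]; last by rewrite mulr0z addr0 modn_small.
have -> : (a + b = k + (a + b) %% k)%N.
  have -> : ((a + b) %% k = a + b - k)%N by rewrite -{1}(subnK kab) modnDr modn_small //; lia.
  lia.
rewrite modnDl modn_mod.
rewrite sigma_D mulr1z addrC -/(sigma k); congr (_ + _).
suff -> : (gen k ^+ k)%g = 1%g by rewrite gelt1 mul1r.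
rewrite -[X in (_ ^+ X)%g](Zp_cast k_ge2) /gen Zp_expg.
by apply: val_inj; rewrite /= mul1n modnn.
Qed.

(** By [path_carry], [sigma] times [carry] is a coboundary, and multiplication
  by [sigma] is injective on integers. *)
Lemma carry_cocycle x y z t :
  carry y z t - carry x z t + carry x y t - carry x y z = 0.
Proof.
have inj (n : int) : sigma k *~ n = 0 -> n = 0.
  move/(congr1 (@ucoef k)); rewrite /ucoef ffunMzE -[sigma k]mulr1.
  by rewrite [X in X *~ _]ucoef_sigma_mul -gelt1 augmentation_gelt intz ffunE.
apply: inj.
rewrite !(mulrzBr, mulrzDr) -!path_carry; ring.
Qed.

Definition bars (s : seq 'Z_k) : seq 'Z_k :=
  if s is x :: s' then pairmap (fun x y : 'Z_k => (x^-1 * y)%g) x s' else [::].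

(** Strong alternation as a cochain, which by [cup_cons3] is a cup power of
  [carry] on symbols with an even number of bars. *)
Definition cup (s : seq 'Z_k) : int := (strongly_alternating (bars s))%:R.

(** The map [f_r] on basis symbols, simultaneously for all [r]. *)
Definition fsymb (s : seq 'Z_k) : Lambda k :=
  gelt (head 1%g s) * fbar (bars s).

Lemma strongly_alternating_cons2 (b c : 'Z_k) (s : seq 'Z_k) :
  strongly_alternating [:: b, c & s] = (k <= b + c)%N && strongly_alternating s.
Proof.
apply/forallP/andP => [H|[kbc /forallP H] [[|i] lti]].
- split; first exact: (H ord0).
  by apply/forallP => -[i lti]; apply: (H (@Ordinal (size s)./2.+1 i.+1 lti)).
- exact: kbc.
- exact: (H (@Ordinal (size s)./2 i lti)).
Qed.

Lemma cup_cons3 x y z s : cup [:: x, y, z & s] = carry x y z * cup (z :: s).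
Proof. by rewrite /cup /= strongly_alternating_cons2 -mulnb natrM. Qed.

Lemma cup1 x : cup [:: x] = 1.
Proof.
by rewrite /cup (_ : strongly_alternating _ = true) //; apply/forallP => -[].
Qed.

(** A cup power of a cocycle is a cocycle; the parity of the size means that the
  faces have an even number of bars. *)
Lemma cup_cocycle n s : size s = n.*2.+2 -> alt cup s = 0.
Proof.
elim: n s => [|n IHn] [|x [|y s]] //=.
  by case: s => //= _; rewrite !cup1 subr0 subrr.
case: s => [|z [|t s]] //= [] sz.
have altE : alt (fun w => cup [:: x, y, z & w]) (t :: s) =
            carry x y z * cup (t :: s).
  rewrite (eq_alt _ (G' := fun w => carry x y z *~ cup (z :: w))); last first.
    by move=> w; rewrite cup_cons3 mulrzz.
  rewrite alt_mulz mulrzz /=.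
  have /= := IHn [:: z, t & s]; rewrite sz => /(_ erefl)/eqP.
  by rewrite subr_eq0 => /eqP <-.
move: altE => /= ->; rewrite !cup_cons3.
have := carry_cocycle x y z t; move: (cup _); lia.
Qed.

Lemma fsymb_even x s : ~~ odd (size s) -> fsymb (x :: s) = gelt x *~ cup (x :: s).
Proof.
move=> es; rewrite /fsymb /fbar /= size_pairmap (negPf es) /fbar_even /cup /=.
by case: ifP => _; rewrite ?mulr1 ?mulr0.
Qed.

Lemma fsymb_odd x y s :
  ~~ odd (size s) -> fsymb [:: x, y & s] = path_elt x y *~ cup (y :: s).
Proof.
move=> es; rewrite /fsymb /fbar /= size_pairmap (negPf es) /= /fbar_even /cup /=.
by rewrite mulrA -/(path_elt x y); case: ifP => _; rewrite ?mulr1 ?mulr0.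
Qed.

(** In even degrees [fsymb] is the cup power itself, and in odd degrees a walk
  [path_elt] followed by it.  As the cup power is a cocycle, the alternating
  sum only sees the boundary of the walk ([tau_path]), respectively the defect
  of additivity of walks ([path_carry]). *)
Lemma alt_fsymb n s : size s = n.+2 -> alt fsymb s = resolution_coef k n.+1 * fsymb s.
Proof.
case: s => [|x [|y s]] //= [] sz; rewrite /resolution_coef /=.
(* The cocycle identity for [v :: w], with the omission of [v] isolated. *)
have altP G (a : Lambda k) v w m : size w = m.*2.+1 ->
    (forall u, (size u).+1 = size w -> G u = a *~ cup (v :: u)) ->
    alt G w = a *~ cup w.
  move=> sw eqG; rewrite (eq_alt_size eqG) alt_mulz.
  have /= := @cup_cocycle m (v :: w); rewrite /= sw => /(_ erefl)/eqP.
  by rewrite subr_eq0 => /eqP <-.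
case: (boolP (odd n)) => /= on; last first.
  have sm : size s = (n./2).*2 by rewrite even_halfK.
  have es : ~~ odd (size s) by rewrite sm odd_double.
  rewrite fsymb_odd // fsymb_even // mulrzAr tau_path mulrzBl; congr (_ - _).
  have /= -> // := altP (fun w => fsymb (x :: w)) (gelt x) x (y :: s) n./2.
    by rewrite /= sm.
  by move=> u /= [su]; rewrite fsymb_even // su.
case: s sz => [|z s] /=; first by case: n on.
case: n on => // n /= en [sz].
have sm : size s = (n./2).*2 by rewrite even_halfK.
have es : ~~ odd (size s) by rewrite sm odd_double.
rewrite (fsymb_even x (s := [:: y, z & s])) /= ?es // mulrzAr mulrC gelt_sigma cup_cons3 mulrzA.
have /= -> // := altP (fun w => fsymb [:: x, y & w]) (path_elt x y) y (z :: s) n./2.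
- by rewrite -path_carry !fsymb_odd // mulrzDl mulrzBl opprB addrA addrAC.
- by rewrite /= sm.
- by move=> u /= [su]; rewrite fsymb_odd // su.
Qed.

End GroupRingFacts.

(** * Alternating chains *)

Section Permute.
Variables (V : finType) (r : nat).
Implicit Types (t : r.+1.-tuple V) (p q : 'S_r.+1).

Lemma permuteM p q t : permute p (permute q t) = permute (p * q)%g t.
Proof. by apply: eq_from_tnth => i; rewrite !tnth_mktuple permM. Qed.

Lemma permute1 t : permute 1%g t = t.
Proof. by apply: eq_from_tnth => i; rewrite tnth_mktuple perm1. Qed.

Lemma permuteK p : cancel (permute p) (@permute V r p^-1%g).
Proof. by move=> t; rewrite permuteM mulVg permute1. Qed.

Lemma permute_inj p : injective (@permute V r p).
Proof. exact: can_inj (@permuteK p). Qed.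

Lemma perm_eq_permute p t : perm_eq (permute p t) t.
Proof. by apply/tuple_permP; exists p. Qed.

Lemma sorted_permute (key : V -> nat) t : uniq (map key t) ->
  exists p0, forall p, sorted ltn (map key (permute p t)) = (p == p0).
Proof.
move=> ut; pose s := sort (relpre key leq) t.
have /tuple_permP[p0 def_s] : perm_eq s t by rewrite /s perm_sort.
have sort0 : sorted ltn (map key (permute p0 t)).
  have <- : s = permute p0 t by [].
  rewrite ltn_sorted_uniq_leq (perm_uniq (perm_map _ (introT permPl (perm_sort _ _)))).
  by rewrite ut sorted_map sort_sorted // => x y; apply: leq_total.
exists p0 => p; apply/idP/eqP => [sortp|->//].
apply/permP => i.
have eqk : map key (permute p t) = map key (permute p0 t).
  apply: (irr_sorted_eq ltn_trans ltnn) => //; apply: perm_mem.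
  by apply: perm_map; rewrite (permPl (perm_eq_permute _ _)) perm_sym perm_eq_permute.
have := congr1 (fun u => nth 0 u i) eqk.
have x0 := tnth t i.
rewrite !(nth_map x0) ?size_tuple // -!tnth_nth !tnth_mktuple => eqi.
have := ut; rewrite -[map _ _]/(tval (map_tuple key t)) => /tuple_uniqP inj.
by apply: inj; rewrite !tnth_map.
Qed.

(** Each tuple with distinct keys is a reordering of exactly one sorted tuple. *)
Lemma sum_permute_sorted (M : zmodType) (key : V -> nat) (g : r.+1.-tuple V -> M) :
  (forall t, ~~ uniq (map key t) -> g t = 0) ->
  \sum_t g t =
  \sum_(t : r.+1.-tuple V | sorted ltn (map key t)) \sum_p g (permute p t).
Proof.
move=> g0.
transitivity (\sum_t \sum_(p : 'S_r.+1 | sorted ltn (map key (permute p t))) g t).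
  apply: eq_bigr => t _; have [ut|nut] := boolP (uniq (map key t)); last first.
    by rewrite g0 // big1.
  have [p0 Hp0] := sorted_permute ut.
  by rewrite (eq_bigl _ _ Hp0) big_pred1_eq.
rewrite (exchange_big_dep xpredT) //= [RHS]exchange_big /=.
rewrite (reindex_inj invg_inj); apply: eq_bigr => p _.
rewrite (reindex_inj (@permute_inj p)) /=.
by apply: eq_bigl => t; rewrite -[in RHS](permuteK p t).
Qed.

End Permute.

Section LinExt.
Variables (V : finType) (r : nat) (M : zmodType).
Implicit Types (t : r.+1.-tuple V) (p q : 'S_r.+1).

Definition alternating_fun (F : r.+1.-tuple V -> M) :=
  forall p t, F (permute p t) = F t *~ (-1) ^+ p.

(** Counting every simplex once for each of its orderings costs a factorial and
  makes the sum invariant under permutations of the vertices; in torsion-free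
  modules the factor can be cancelled afterwards. *)
Lemma lin_ext_fact (F : r.+1.-tuple V -> M) (X : {set {set V}}) (c : chain V r) :
  alternating_fun F -> in_chains X c ->
  lin_ext F c *+ r.+1`! = \sum_t F t *~ c t.
Proof.
move=> altF [altc unc].
rewrite (@sum_permute_sorted _ _ _ (fun v => enum_rank v : nat)); last first.
  move=> t nut; case: (eqVneq (c t) 0) => [->|/unc[ut _]]; first by rewrite mulr0z.
  case/negP: nut; rewrite map_inj_uniq //.
  by move=> x y /ord_inj/enum_rank_inj.
rewrite /lin_ext -sumrMnl; apply: eq_bigr => t _.
rewrite (eq_bigr (fun=> F t *~ c t)) => [|p _].
  by rewrite sumr_const -card_Sn.
rewrite altF altc -mulrzA; congr (_ *~ _).
by rewrite mulrA -expr2 sqrr_sign mul1r.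
Qed.

End LinExt.

(** A permutation is given by the image of [0] and a permutation of the other
  positions: the map is injective, and the cardinalities agree. *)
Lemma sum_lift_perm (M : zmodType) n (g : 'S_n.+1 -> M) :
  \sum_q g q = \sum_(i < n.+1) \sum_(p : 'S_n) g (lift_perm ord0 i p).
Proof.
pose L (ip : 'I_n.+1 * 'S_n) := lift_perm ord0 ip.1 ip.2.
have injL : injective L.
  move=> [i p] [j q] /permP /= eqL.
  have eij : i = j by have := eqL ord0; rewrite !lift_perm_id.
  congr (_, _) => //; apply/permP => k.
  by have := eqL (lift ord0 k); rewrite !lift_perm_lift eij => /lift_inj.
rewrite pair_big (reindex L) //=; apply: onW_bij; apply: inj_card_bij => //.
by rewrite card_prod card_ord !card_Sn factS.
Qed.

Section Boundary.
Variables (V : finType).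

Definition tcons r (v : V) (t : r.+1.-tuple V) : r.+2.-tuple V := [tuple of v :: t].
Definition tbehead r (t : r.+2.-tuple V) : r.+1.-tuple V := [tuple of behead t].

Lemma tnth_tbehead r (t : r.+2.-tuple V) i : tnth (tbehead t) i = tnth t (lift ord0 i).
Proof. by rewrite tnth_behead; congr tnth; apply: val_inj; rewrite /= inordK // ltnS. Qed.

Lemma tbehead_permute r (t : r.+2.-tuple V) (i : 'I_r.+2) (p : 'S_r.+1) :
  tbehead (permute (lift_perm ord0 i p) t) = permute p (face i t).
Proof.
apply: eq_from_tnth => j.
by rewrite tnth_tbehead !tnth_mktuple lift_perm_lift.
Qed.

Lemma sum_tcons (M : zmodType) r (g : r.+2.-tuple V -> M) :
  \sum_t g t = \sum_(w : r.+1.-tuple V) \sum_v g (tcons v w).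
Proof.
rewrite pair_big /= (reindex (fun wv : r.+1.-tuple V * V => tcons wv.2 wv.1)) //=.
exists (fun t => (tbehead t, thead t)) => [[w v] _|t _] /=.
  by congr (_, _); apply: val_inj.
by case/tupleP: t => v w; apply: val_inj.
Qed.

(** A multiple of the alternating sum of the values of [G] at the faces of [t]
  if [G] is alternating ([sgn_sumE]); written as a sum over all orderings it
  is alternating in [t] for trivial reasons. *)
Definition sgn_sum (M : zmodType) r (G : r.+1.-tuple V -> M) (t : r.+2.-tuple V) : M :=
  \sum_(q : 'S_r.+2) G (tbehead (permute q t)) *~ (-1) ^+ q.

Lemma alternating_sgn_sum (M : zmodType) r (G : r.+1.-tuple V -> M) :
  alternating_fun (sgn_sum G).
Proof.
move=> p t; rewrite /sgn_sum mulrz_suml (reindex_inj (mulIg p^-1%g)) /=.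
apply: eq_bigr => q _; rewrite permuteM mulgKV -mulrzA; congr (_ *~ _).
by rewrite odd_permM odd_permV signr_addb.
Qed.

Lemma sgn_sumE (M : zmodType) r (G : r.+1.-tuple V -> M) t : alternating_fun G ->
  sgn_sum G t = (\sum_(i < r.+2) G (face i t) *~ (-1) ^+ i) *+ r.+1`!.
Proof.
move=> altG; rewrite /sgn_sum sum_lift_perm -sumrMnl; apply: eq_bigr => i _.
rewrite (eq_bigr (fun=> G (face i t) *~ (-1) ^+ i)) => [|p _].
  by rewrite sumr_const -card_Sn.
rewrite tbehead_permute altG -mulrzA; congr (_ *~ _).
rewrite odd_lift_perm /= signr_addb mulrCA -expr2 sqrr_sign mulr1.
by rewrite signr_odd.
Qed.

(** Reordering [t] by [q] turns the term of [q] into the term of the face that is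
  opposite to the first vertex. *)
Lemma sum_sgn_sum (M : zmodType) r (G : r.+1.-tuple V -> M) (c : chain V r.+1) :
  (forall p t, c (permute p t) = (-1) ^+ p * c t) ->
  \sum_t sgn_sum G t *~ c t =
  (\sum_(w : r.+1.-tuple V) G w *~ \sum_v c (tcons v w)) *+ r.+2`!.
Proof.
move=> altc; under eq_bigr => t _ do rewrite /sgn_sum mulrz_suml.
rewrite exchange_big /= -[in RHS]card_Sn -sumr_const; apply: eq_bigr => q _.
transitivity (\sum_(t : r.+2.-tuple V) G (tbehead t) *~ c t).
  rewrite [RHS](reindex_inj (@permute_inj _ _ q)) /=; apply: eq_bigr => t _.
  by rewrite altc mulrzA.
rewrite sum_tcons; apply: eq_bigr => w _; rewrite mulrz_sumr.
by apply: eq_bigr => v _; congr (G _ *~ _); apply: val_inj.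
Qed.

(** A simplex that has [w] as a face can be oriented so that the additional
  vertex comes first. *)
Lemma boundaryE r (X : {set {set V}}) (c : chain V r.+1) (w : r.+1.-tuple V) :
  in_chains X c -> boundary c w = \sum_v c (tcons v w).
Proof.
move=> Xc.
pose D : r.+1.-tuple V -> int := fun u => (u == w)%:R.
have oE (u : r.+1.-tuple V) : osimplex u w =
    \sum_(p : 'S_r.+1) D (permute p u) *~ (-1) ^+ p.
  rewrite ffunE [LHS]big_mkcond; apply: eq_bigr => p _.
  by rewrite /D; case: eqP => _; rewrite ?mul0rz // intz.
have FE (t : r.+2.-tuple V) :
    (\sum_(i < r.+2) osimplex (face i t) *~ (-1) ^+ i) w = sgn_sum D t.
  rewrite sum_ffunE /sgn_sum sum_lift_perm; apply: eq_bigr => i _.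
  rewrite ffunMzE oE mulrz_suml; apply: eq_bigr => p _.
  rewrite tbehead_permute -mulrzA; congr (_ *~ _).
  by rewrite odd_lift_perm /= signr_addb signr_odd mulrC.
have : boundary c w *+ r.+2`! = (\sum_v c (tcons v w)) *+ r.+2`!.
  have -> : boundary c w = lin_ext (sgn_sum D) c.
    by rewrite /boundary /lin_ext sum_ffunE; apply: eq_bigr => t _; rewrite ffunMzE FE.
  rewrite (lin_ext_fact (@alternating_sgn_sum _ _ D) Xc) sum_sgn_sum; last by case: Xc.
  rewrite (bigD1 w) //= [X in _ + X]big1 => [|u /negPf nuw]; last by rewrite /D nuw mul0rz.
  by rewrite addr0 /D eqxx intz.
by move/eqP; rewrite eqr_pMn2r ?fact_gt0 // => /eqP.
Qed.

End Boundary.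

Section Omit.
Variable T : Type.

Definition omit (i : nat) (s : seq T) : seq T := take i s ++ drop i.+1 s.

Lemma nth_omit x0 i s j : (i < size s)%N -> nth x0 (omit i s) j = nth x0 s (bump i j).
Proof.
move=> lti; rewrite /omit nth_cat size_take lti nth_drop /bump.
case: ltnP => [ltji|leij]; first by rewrite nth_take // leqNgt ltji.
by rewrite addSn subnKC // leij.
Qed.

Lemma size_omit i s : (i < size s)%N -> size (omit i s) = (size s).-1.
Proof. by move=> lti; rewrite /omit size_cat size_take lti size_drop; lia. Qed.

Lemma altE (M : zmodType) (G : seq T -> M) s :
  alt G s = \sum_(i < size s) G (omit i s) *~ (-1) ^+ i.
Proof.
elim: s G => [|x s IHs] G /=; first by rewrite big_ord0.
rewrite big_ord_recl /= expr0 mulr1z {1}/omit /= drop0; congr (_ + _).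
rewrite IHs -sumrN; apply: eq_bigr => i _.
by rewrite exprS mulN1r mulrNz.
Qed.

End Omit.

Lemma face_omit (V : finType) r (t : r.+2.-tuple V) (i : 'I_r.+2) :
  tval (face i t) = omit i t.
Proof.
have x0 := tnth t ord0.
have lti : (i < size t)%N by rewrite size_tuple.
apply: (@eq_from_nth _ x0) => [|j]; first by rewrite size_omit // !size_tuple.
rewrite size_tuple => ltj; rewrite nth_omit //.
by rewrite -(tnth_nth _ _ (Ordinal ltj)) tnth_mktuple (tnth_nth x0).
Qed.

Lemma alt_face (V : finType) (M : zmodType) (G : seq V -> M) r (t : r.+2.-tuple V) :
  alt G t = \sum_(i < r.+2) G (face i t) *~ (-1) ^+ i.
Proof.
rewrite altE (eq_bigr (fun i : 'I_(size t) => G (omit i t) *~ (-1) ^+ i)) //.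
rewrite -(big_mkord xpredT (fun i => G (omit i t) *~ (-1) ^+ i)) size_tuple big_mkord.
by apply: eq_bigr => i _; rewrite face_omit.
Qed.

(** * The action on the vertices of a subdivision *)

Section Geometry.
Variables (R : realType) (E : lmodType R) (V : finType) (pos : V -> E).

Lemma hull_vertex (A : {set V}) v : v \in A -> hull pos A (pos v).
Proof.
move=> vA; exists (fun u => (u == v)%:R); split => [u _||]; first by rewrite ler0n.
  rewrite (bigD1 v) //= eqxx big1 ?addr0 // => u /andP[_ /negPf nuv].
  by rewrite nuv.
rewrite (bigD1 v) //= eqxx scale1r big1 ?addr0 // => u /andP[_ /negPf nuv].
by rewrite nuv scale0r.
Qed.

Lemma hull0 x : ~ hull pos finset.set0 x.
Proof. by case=> w [_ /eqP]; rewrite big_set0 eq_sym oner_eq0. Qed.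

(** The simplices of two distinct vertices have no common point. *)
Lemma pos_inj (X : {set {set V}}) : geometric_complex pos X -> injective pos.
Proof.
case=> [_ vX _ cap] v w eqvw; apply/eqP/negPn/negP => nvw.
have hv : hull pos [set v]%SET (pos v) by apply: hull_vertex; rewrite set11.
have hw : hull pos [set w]%SET (pos v) by rewrite eqvw; apply: hull_vertex; rewrite set11.
have : (hull pos [set v]%SET `&` hull pos [set w]%SET)%classic (pos v) by [].
rewrite cap // (_ : [set v] :&: [set w] = finset.set0)%SET; first exact: hull0.
by apply/setP => u; rewrite !inE; apply/negP => /andP[/eqP-> /eqP eqw]; case/eqP: nvw.
Qed.

End Geometry.

Section Action.
Variables (R : realType) (k m : nat) (X : equivariant_subdivision R k m).

Lemma join_actM (h h' : 'Z_k) (x : 'M[R]_((Zp_trunc k).+2, m)) :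
  join_act h (join_act h' x) = join_act (h * h')%g x.
Proof. by apply/matrixP => s j; rewrite !mxE invMg mulgA. Qed.

Lemma join_act1 (x : 'M[R]_((Zp_trunc k).+2, m)) : join_act (k := k) 1%g x = x.
Proof. by apply/matrixP => s j; rewrite !mxE invg1 mul1g. Qed.

Lemma vertex_pos_inj : injective (@pos _ _ _ X).
Proof. by have [gX _ _] := simpP X; apply: (pos_inj gX). Qed.

Lemma vertex_actM h h' (v : vert X) : act h (act h' v) = act (h * h')%g v.
Proof. by apply: vertex_pos_inj; rewrite !actP join_actM. Qed.

Lemma vertex_act1 (v : vert X) : act (e := X) 1%g v = v.
Proof. by apply: vertex_pos_inj; rewrite !actP join_act1. Qed.

Lemma vertex_actK h : cancel (@act _ _ _ X h) (@act _ _ _ X h^-1%g).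
Proof. by move=> v; rewrite vertex_actM mulVg vertex_act1. Qed.

Lemma tactK r h : cancel (@tact k _ r (@act _ _ _ X) h) (tact (@act _ _ _ X) h^-1%g).
Proof. by move=> t; apply: eq_from_tnth => i; rewrite !tnth_map vertex_actK. Qed.

Lemma permute_tact r p h (t : r.+1.-tuple (vert X)) :
  permute p (tact (@act _ _ _ X) h t) = tact (@act _ _ _ X) h (permute p t).
Proof. by apply: eq_from_tnth => i; rewrite !(tnth_mktuple, tnth_map). Qed.

End Action.

(** * Labellings and the periodic resolution *)

Lemma LambdaMn_inj k n (a b : Lambda k) : (0 < n)%N -> a *+ n = b *+ n -> a = b.
Proof.
move=> n0 /ffunP eqab; apply/ffunP => h; have := eqab h.
rewrite !ffunMnE => /eqP; rewrite eqr_pMn2r // => /eqP; exact.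
Qed.

Section LabelledChains.
Variables (R : realType) (k m : nat) (X : equivariant_subdivision R k m).
Hypothesis k_ge2 : (2 <= k)%N.
Variable l : vert X -> 'Z_k * nat.
Hypotheses (adm : admissible l) (eqv : equivariant l).

(** The composite of [h_r^l] and [f_r] on oriented simplices. *)
Definition fpattern r (t : r.+1.-tuple (vert X)) : Lambda k := fr (pattern l t).

Lemma fr_sum r (I : Type) (s : seq I) (P : pred I) (F : I -> Sr k r) (n : I -> int) :
  fr (\sum_(i <- s | P i) F i *~ n i) = \sum_(i <- s | P i) fr (F i) *~ n i.
Proof.
rewrite /fr; under [RHS]eq_bigr => i _ do rewrite mulrz_suml.
rewrite exchange_big /=; apply: eq_bigr => t _.
rewrite sum_ffunE mulrz_sumr; apply: eq_bigr => i _.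
by rewrite ffunMzE mulrzz mulrzA.
Qed.

Lemma fr_symb r (t : r.+1.-tuple 'Z_k) : fr (symb t) = fsymb t.
Proof.
rewrite /fr (bigD1 t) //= [X in _ + X]big1 => [|u /negPf nut]; last first.
  by rewrite ffunE nut mulr0z.
rewrite addr0 ffunE eqxx mulr1z; case/tupleP: t => x s.
by rewrite /fsymb /bar /= theadE.
Qed.

Lemma fpatternE r (t : r.+1.-tuple (vert X)) : fpattern t =
  \sum_(p : 'S_r.+1 | sorted ltn [seq (l v).2 | v <- permute p t])
    fsymb [seq (l v).1 | v <- permute p t] *~ (-1) ^+ p.
Proof. by rewrite /fpattern fr_sum; apply: eq_bigr => p _; rewrite fr_symb. Qed.

Lemma fr_hl r (c : chain (vert X) r) : fr (hl l c) = lin_ext (@fpattern r) c.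
Proof. exact: fr_sum. Qed.

Lemma alternating_fpattern r : alternating_fun (@fpattern r).
Proof.
move=> q t; rewrite !fpatternE mulrz_suml (reindex_inj (mulIg q^-1%g)).
apply: eq_big => [p|p _]; first by rewrite permuteM mulgKV.
rewrite permuteM mulgKV -mulrzA; congr (_ *~ _).
by rewrite odd_permM odd_permV signr_addb.
Qed.

Lemma fpattern_sorted r (t : r.+1.-tuple (vert X)) :
  sorted ltn [seq (l v).2 | v <- t] -> fpattern t = fsymb [seq (l v).1 | v <- t].
Proof.
move=> st; have [p0 Hp0] := sorted_permute (sorted_uniq ltn_trans ltnn st).
have p01 : p0 = 1%g by have := Hp0 1%g; rewrite permute1 st => /esym/eqP.
rewrite fpatternE (eq_bigl _ _ Hp0) big_pred1_eq p01 permute1.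
by rewrite odd_perm1 mulr1z.
Qed.

Lemma map_permute_eq r p (t u : r.+1.-tuple (vert X)) :
  map l t = map l u -> map l (permute p t) = map l (permute p u).
Proof.
move=> eqtu; rewrite /= -!map_comp; apply: eq_map => j /=.
have x0 := thead t; rewrite !(tnth_nth x0) -!(nth_map _ (l x0)) ?size_tuple //.
by rewrite eqtu.
Qed.

Lemma fpattern_eq_labels r (t u : r.+1.-tuple (vert X)) :
  map l t = map l u -> fpattern t = fpattern u.
Proof.
move=> eqtu; have E p := map_permute_eq p eqtu.
rewrite !fpatternE; apply: eq_big => [p|p _].
  by rewrite !(map_comp snd l) E.
by rewrite !(map_comp fst l) E.
Qed.

(** Here admissibility enters.  Two vertices of the same color also have the same
  sign, so that exchanging them preserves the labels and reverses the sign of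
  both sides, which therefore vanish.  If the colors are distinct, the vertices
  may be sorted by color, and the identity becomes [alt_fsymb]. *)
Lemma sgn_sum_fpattern r (t : r.+2.-tuple (vert X)) :
  uniq t -> [set v in t] \in simp X ->
  sgn_sum (@fpattern r) t = (resolution_coef k r.+1 * fpattern t) *+ r.+1`!.
Proof.
move=> ut tX; have [uc|] := boolP (uniq [seq (l v).2 | v <- t]); last first.
  case/(uniqPn 0%N) => a [b []]; rewrite size_map size_tuple => ltab ltb.
  have lta := ltn_trans ltab ltb.
  have x0 := thead t; rewrite !(nth_map x0) ?size_tuple // => eqc.
  pose i := Ordinal lta; pose j := Ordinal ltb.
  have nij : i != j by rewrite -val_eqE /= neq_ltn ltab.
  have eql : l (tnth t i) = l (tnth t j).
    move: eqc; rewrite -(tnth_nth _ _ i) -(tnth_nth _ _ j) => eqc.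
    have nvw : tnth t i != tnth t j.
      by apply: contra nij => /eqP/(tuple_uniqP _ ut)->.
    have [_ closed] : simplicial_complex (simp X) by have [[]] := simpP X.
    have /(adm nvw) : [set tnth t i; tnth t j] \in simp X.
      apply: (closed _ _ tX).
        by apply/fintype.subsetP => v /set2P[]->; rewrite inE mem_tnth.
      by apply/set0Pn; exists (tnth t i); rewrite set21.
    by case=> // eqs; rewrite (surjective_pairing (l (tnth t i))) eqs eqc -surjective_pairing.
  have lE : map l (permute (tperm i j) t) = map l t.
    rewrite -[in RHS](permute1 t) /= -!map_comp; apply: eq_map => q /=.
    by rewrite perm1; case: tpermP => // ->.
  have half0 (y : Lambda k) : y = y *~ -1 -> y = 0.
    move=> /eqP; rewrite mulrNz mulr1z -addr_eq0 -mulr2n => /eqP y0.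
    by apply: (@LambdaMn_inj _ 2) => //; rewrite y0 mul0rn.
  have -> : fpattern t = 0.
    apply: half0; have := alternating_fpattern (tperm i j) t.
    by rewrite (fpattern_eq_labels lE) odd_tperm nij expr1.
  rewrite mulr0 mul0rn; apply: half0.
  have := alternating_sgn_sum (@fpattern r) (tperm i j) t.
  rewrite odd_tperm nij expr1 => <-; rewrite /sgn_sum; apply: eq_bigr => p _.
  rewrite (@fpattern_eq_labels _ _ (tbehead (permute p (permute (tperm i j) t)))) //.
  rewrite -[RHS]behead_map -[LHS]behead_map; congr behead; apply: map_permute_eq.
  by rewrite lE.
have [q Hq] := sorted_permute uc.
have sq : sorted ltn [seq (l v).2 | v <- permute q t] by rewrite Hq.
suff E : sgn_sum (@fpattern r) (permute q t) = (resolution_coef k r.+1 * fpattern (permute q t)) *+ r.+1`!.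
  move: E; rewrite alternating_sgn_sum alternating_fpattern mulrzAr.
  by case: (odd_perm q); rewrite ?expr0 ?expr1 ?mulrNz !mulr1z // mulNrn => /oppr_inj.
move: (permute q t) sq => u su {Hq}.
rewrite sgn_sumE; last exact: alternating_fpattern.
congr (_ *+ _); rewrite (fpattern_sorted su).
have := alt_fsymb k_ge2 (n := r) (s := [seq (l v).1 | v <- u]).
rewrite size_map size_tuple => <- //.
rewrite alt_map alt_face; apply: eq_bigr => i _; congr (_ *~ _).
apply: fpattern_sorted; rewrite face_omit; apply: subseq_sorted su; first exact: ltn_trans.
apply: map_subseq; rewrite -{2}(cat_take_drop i u) /omit.
by rewrite cat_subseq // -add1n -drop_drop drop_subseq.
Qed.

Lemma fsymb_mul h s : s != [::] ->
  fsymb [seq (h * x)%g | x <- s] = gelt h * fsymb s :> Lambda k.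
Proof.
case: s => //= x s _; rewrite /fsymb /= geltM -mulrA; congr (_ * (_ * fbar _)).
by elim: s x => //= y s IHs x; rewrite IHs invMg -mulgA mulKg.
Qed.

Lemma fpattern_act r h (t : r.+1.-tuple (vert X)) :
  fpattern (tact (@act _ _ _ X) h t) = gelt h * fpattern t.
Proof.
rewrite !fpatternE mulr_sumr; apply: eq_big => [p|p _].
  rewrite permute_tact /= -!map_comp; congr (sorted _ _); apply: eq_map => i /=.
  by rewrite eqv.
rewrite permute_tact mulrzAr; congr (_ *~ _); rewrite -fsymb_mul.
  by congr fsymb; rewrite /= -!map_comp; apply: eq_map => i /=; rewrite eqv.
by rewrite -size_eq0 size_map size_tuple.
Qed.

Lemma sum_fpattern_act r (a : Lambda k) (c : chain (vert X) r) :
  \sum_t fpattern t *~ chain_act a c t = a * \sum_t fpattern t *~ c t.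
Proof.
rewrite {2}(Lambda_sum_gelt a) mulr_suml /chain_act.
under eq_bigr => t _ do rewrite ffunE mulrz_sumr.
rewrite exchange_big /=; apply: eq_bigr => h _.
rewrite (reindex_inj (can_inj (@tactK _ _ _ X r.+1 h))) mulr_sumr.
apply: eq_bigr => t _; rewrite tactK fpattern_act.
by rewrite [RHS]mulrzAl [in RHS]mulrzAr -[RHS]mulrzA [a h * _]mulrC.
Qed.

(** The equations of a generalized sphere hold for the images of its chains in the
  periodic resolution.  Both sides are compared after multiplication by the
  factorials that turn them into sums over all orderings. *)
Lemma generalized_sphere_step r (x : forall i, chain (vert X) i) :
  in_chains (simp X) (x r) -> in_chains (simp X) (x r.+1) ->
  boundary (x r.+1) = chain_act (resolution_coef k r.+1) (x r) ->
  resolution_coef k r.+1 * fr (hl l (x r.+1)) = resolution_coef k r.+1 * fr (hl l (x r)).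
Proof.
move=> Xr Xr1 bd; rewrite !fr_hl.
have n0 : (0 < r.+1`! * r.+2`!)%N by rewrite muln_gt0 !fact_gt0.
apply: (LambdaMn_inj n0).
transitivity (\sum_t sgn_sum (@fpattern r) t *~ x r.+1 t).
  rewrite mulnC mulrnA -mulrnAr (lin_ext_fact (@alternating_fpattern _) Xr1).
  rewrite mulr_sumr -sumrMnl; apply: eq_bigr => t _.
  have [->|/(proj2 Xr1)[ut tX]] := eqVneq (x r.+1 t) 0.
    by rewrite !mulr0z mulr0 mul0rn.
  by rewrite sgn_sum_fpattern // mulrzAr !pmulrn -!mulrzA [c in _ *~ c]mulrC.
rewrite (sum_sgn_sum _ (proj1 Xr1)) [RHS]mulrnA -[X in _ = X *+ _]mulrnAr.
rewrite (lin_ext_fact (@alternating_fpattern _) Xr) -sum_fpattern_act -bd.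
by congr (_ *+ _); apply: eq_bigr => w _; rewrite (boundaryE _ Xr1).
Qed.

(** An element killed by [tau] is invariant under the group, hence constant as a
  function on it, and its augmentation is a multiple of [k]; the augmentation
  of an element killed by [sigma] is zero. *)
Lemma augmentation_resolution_coef r (a b : Lambda k) :
  resolution_coef k r * a = resolution_coef k r * b -> (augmentation a = augmentation b %[mod k%:Z])%Z.
Proof.
rewrite /resolution_coef; case: ifP => _; last by rewrite -!(ucoef_sigma_mul k_ge2) => ->.
have [v ->] : exists v, a = b + v by exists (a - b); rewrite addrC subrK.
move=> /eqP; rewrite mulrDr addrC -subr_eq0 addrK => /eqP t0.
have vg h : v (gen k * h)%g = v h.
  have /ffunP/(_ (gen k * h)%g) := t0; rewrite /tau mulrBl mul1r !ffunE.
  rewrite (bigD1 (gen k)) //= [X in _ + X - _]big1 => [|u /negPf nu]; last first.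
    by rewrite ffunE nu mul0r.
  by rewrite ffunE eqxx mul1r mulKg addr0 => /eqP; rewrite subr_eq0 => /eqP ->.
have v1 h : v h = v 1%g.
  rewrite -(gen_expg h); elim: (h : nat) => [|i IHi]; first by rewrite expg0.
  by rewrite expgS vg.
rewrite augmentationD addrC (_ : augmentation v = v 1%g * k%:Z) ?modzMDl //.
rewrite /augmentation (eq_bigr (fun=> v 1%g)) // sumr_const card_ord.
by rewrite [X in _ *+ X](Zp_cast k_ge2) -mulr_natr natz.
Qed.

(** The number [alpha] is an augmentation, and modulo [k] the augmentation passes
  unchanged from each degree to the next. *)
Lemma alpha_generalized_sphere n (x : forall i, chain (vert X) i) :
  generalized_sphere n x -> (augmentation (fr (hl l (x 0%N))) = 1 %[mod k%:Z])%Z ->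
  (alpha l (x n) = 1 %[mod k%:Z])%Z.
Proof.
move=> [Xx bd] base; rewrite /alpha ucoef_sigma_mul //.
suff: forall i, (i <= n)%N -> (augmentation (fr (hl l (x i))) = 1 %[mod k%:Z])%Z by apply.
elim=> [//|i IHi] lein; rewrite -IHi 1?ltnW //.
apply: (augmentation_resolution_coef (r := i.+1)); apply: generalized_sphere_step; try exact: Xx.
  by apply: Xx; apply: ltnW.
exact: bd.
Qed.

End LabelledChains.

(** * Barycentric coordinates in the join *)

Section Realization.
Variables (R : realType) (k m : nat) (X : equivariant_subdivision R k m).
Notation J := ('Z_k * 'I_m)%type.
Notation V := (vert X).
Implicit Types (v : V) (p : J) (A : {set V}).

(** A point of the realization of the join is the matrix of its barycentric
  coordinates. *)
Definition entry (x : 'M[R]_((Zp_trunc k).+2, m)) (p : J) : R := x p.1 p.2.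

Lemma entry_eq x y : entry x =1 entry y -> x = y.
Proof. by move=> eqxy; apply/matrixP => s j; apply: (eqxy (s, j)). Qed.

Lemma entryD x y p : entry (x + y) p = entry x p + entry y p.
Proof. by rewrite /entry mxE. Qed.

Lemma entryZ a x p : entry (a *: x) p = a * entry x p.
Proof. by rewrite /entry mxE. Qed.

Lemma entry_sum (I : Type) (s : seq I) (P : pred I) (a : I -> R) F p :
  entry (\sum_(i <- s | P i) a i *: F i) p = \sum_(i <- s | P i) a i * entry (F i) p.
Proof. by rewrite /entry summxE; apply: eq_bigr => i _; rewrite mxE. Qed.

Lemma hull_joinP (B : {set J}) x : hull (@join_vertex R k m) B x <->
  [/\ forall p, 0 <= entry x p, \sum_p entry x p = 1 &
      forall p, entry x p != 0 -> p \in B].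
Proof.
have vE p q : entry (join_vertex R p) q = (q == p)%:R.
  by rewrite /entry mxE -pair_eqE.
have cE (w : J -> R) q :
    \sum_(p in B) w p * entry (join_vertex R p) q = if q \in B then w q else 0.
  case: ifP => [qB|/negP qB].
    rewrite (bigD1 q) //= vE eqxx mulr1 big1 ?addr0 // => p /andP[_ /negPf npq].
    by rewrite vE eq_sym npq mulr0.
  rewrite big1 // => p pB; rewrite vE; case: eqP => [eqp|_]; last by rewrite mulr0.
  by case: qB; rewrite eqp.
split=> [[w [w0 w1 ->]]|[x0 x1 xB]].
  split=> [p||p]; rewrite ?entry_sum ?cE.
  - by case: ifP => // /w0.
  - rewrite -w1 [RHS]big_mkcond; apply: eq_bigr => p _.
    by rewrite entry_sum cE.
  - by case: ifP => //; rewrite eqxx.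
exists (entry x); split=> //.
  rewrite -x1 big_mkcond; apply: eq_bigr => p _.
  by case: ifPn => // pB; apply/esym/eqP; apply: contraR pB => /xB.
apply: entry_eq => q; rewrite entry_sum cE.
by case: ifPn => // qB; apply/eqP; apply: contraR qB => /xB.
Qed.

Lemma simp_complex : simplicial_complex (simp X).
Proof. by have [[]] := simpP X. Qed.

Lemma simp_sub A (B : {set V}) : A \in simp X -> B \subset A -> B != finset.set0 -> B \in simp X.
Proof. by have [_] := simp_complex; apply. Qed.

Lemma entry_pos_ge0 v p : 0 <= entry (pos v) p.
Proof.
have [[_ vX _ _] sub _] := simpP X.
have [B BK hB] := sub _ (vX v).
by have /hB/hull_joinP[] : hull (@pos _ _ _ X) [set v]%SET (pos v) by apply: hull_vertex; rewrite set11.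
Qed.

Lemma entry_pos_sum v : \sum_p entry (pos v) p = 1.
Proof.
have [[_ vX _ _] sub _] := simpP X.
have [B BK hB] := sub _ (vX v).
by have /hB/hull_joinP[] : hull (@pos _ _ _ X) [set v]%SET (pos v) by apply: hull_vertex; rewrite set11.
Qed.

Lemma sum_entry_sum (I : finType) (P : pred I) (a : I -> R) (f : I -> V) :
  \sum_p entry (\sum_(i | P i) a i *: pos (f i)) p = \sum_(i | P i) a i.
Proof.
under eq_bigr => p _ do rewrite entry_sum.
rewrite exchange_big /=; apply: eq_bigr => i _.
by rewrite -mulr_sumr entry_pos_sum mulr1.
Qed.

(** Affine and linear independence agree, as all vertices lie in the hyperplane on
  which the barycentric coordinates add up to one. *)
Lemma linear_independent A (a : V -> R) : A \in simp X ->
  \sum_(v in A) a v *: pos v = 0 -> forall v, v \in A -> a v = 0.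
Proof.
move=> AX a0; have [[_ _ ind _] _ _] := simpP X.
apply: (ind _ AX) => //; rewrite -(sum_entry_sum _ _ id) a0 big1 // => p _.
by rewrite /entry mxE.
Qed.

(** A simplex that contains [x] can be cut down to the vertices that have a
  positive weight in [x]. *)
Lemma carrier x (B : {set J}) : B \in join_complex k m ->
  (forall p, 0 <= entry x p) -> \sum_p entry x p = 1 ->
  (forall p, entry x p != 0 -> p \in B) ->
  exists A (a : V -> R), [/\ A \in simp X, forall v, v \in A -> 0 < a v &
    x = \sum_(v in A) a v *: pos v].
Proof.
move=> BK x0 x1 xB; have [_ _ eqXK] := simpP X.
have : polyhedron (@pos _ _ _ X) (simp X) x.
  by rewrite eqXK; exists B => //; apply/hull_joinP.
case=> A AX [a [a0 a1 xE]].
exists [set v in A | 0 < a v]%SET, a; split=> [|v|].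
- apply: (simp_sub AX); first by apply/fintype.subsetP => v; rewrite inE => /andP[].
  apply/negP => /eqP/setP A0; have /eqP := a1; rewrite big1 ?(eq_sym 0) ?oner_eq0 // => v vA.
  apply/eqP; rewrite eq_le a0 // andbT leNgt; apply/negP => av.
  by have := A0 v; rewrite !inE vA av.
- by rewrite inE => /andP[].
rewrite xE [RHS](eq_bigl (fun v => (v \in A) && (0 < a v))); last by move=> v; rewrite inE.
rewrite big_mkcondr; apply: eq_bigr => v vA; case: ifPn => // av.
by rewrite (_ : a v = 0) ?scale0r //; apply/eqP; rewrite eq_le a0 // andbT leNgt.
Qed.

(** Nonnegative coordinates do not cancel: the carrier of a point lies in the
  simplex of the join that carries this point. *)
Lemma carrier_support A (a : V -> R) v p : (forall v, v \in A -> 0 < a v) ->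
  v \in A -> entry (pos v) p != 0 -> entry (\sum_(v in A) a v *: pos v) p != 0.
Proof.
move=> a0 vA vp; rewrite entry_sum gt_eqF // (bigD1 v) //=.
apply: ltr_wpDr; last by rewrite mulr_gt0 ?a0 // lt_neqAle eq_sym vp entry_pos_ge0.
by apply: sumr_ge0 => u /andP[uA _]; rewrite mulr_ge0 ?entry_pos_ge0 // ltW ?a0.
Qed.

Lemma hull_tuple n (t : n.-tuple V) (a : 'I_n -> R) A : (forall i, 0 <= a i) ->
  \sum_i a i = 1 -> {subset t <= A} ->
  hull (@pos _ _ _ X) A (\sum_i a i *: pos (tnth t i)).
Proof.
move=> a0 a1 tA; have tiA i : tnth t i \in A by rewrite tA ?mem_tnth.
exists (fun v => \sum_(i | tnth t i == v) a i); split.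
- by move=> v _; apply: sumr_ge0.
- by rewrite -a1 [RHS](partition_big (tnth t) (mem A)) // => i _; apply: tiA.

rewrite [LHS](partition_big (tnth t) (mem A)) => [|i _]; last exact: tiA.
apply: eq_bigr => v _.
by rewrite scaler_suml; apply: eq_bigr => i /eqP->.
Qed.

End Realization.

(** * The subdivision operator *)

Section SubdivisionOperator.
Variables (R : realType) (k m : nat) (X : equivariant_subdivision R k m).
Notation J := ('Z_k * 'I_m)%type.
Notation V := (vert X).
Variable p0 : J.
Implicit Types (v : V) (p : J) (T : seq J).

Definition supported T v := [forall p, (entry (pos v) p != 0) ==> (p \in T)].

Definition coord_mx T r (t : r.+1.-tuple V) : 'M[R]_r.+1 :=
  \matrix_(i, j) entry (pos (tnth t i)) (nth p0 T j).

(** The coefficient of the simplex [t] of [X] in the subdivision of the simplex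
  [T] of the join: its orientation relative to [T], if it lies in [T]. *)
Definition subdiv T r (t : r.+1.-tuple V) : int :=
  if ([set v in t]%SET \in simp X) && all (supported T) t
  then sgz (\det (coord_mx T t)) else 0.

Lemma supportedP T v : reflect (forall p, entry (pos v) p != 0 -> p \in T) (supported T v).
Proof. by apply: (iffP forallP) => H p; apply/implyP; apply: H. Qed.

Lemma subdiv_uniq T r (t : r.+1.-tuple V) : subdiv T t != 0 -> uniq t.
Proof.
rewrite /subdiv; case: ifP; rewrite ?eqxx // => _; apply: contraR => nut.
rewrite sgz_eq0; have [i [j [nij eqij]]] : exists i j, i != j /\ tnth t i = tnth t j.
  have v0 := thead t; case/(uniqPn v0): nut => i [j []].
  rewrite size_tuple => ltij ltj eqij.
  exists (Ordinal (ltn_trans ltij ltj)), (Ordinal ltj).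
  by rewrite -val_eqE /= neq_ltn ltij !(tnth_nth v0).
by apply/eqP/(determinant_alternate nij) => l; rewrite !mxE eqij.
Qed.

Lemma subdiv_permute T r (t : r.+1.-tuple V) (p : 'S_r.+1) :
  subdiv T (permute p t) = (-1) ^+ p * subdiv T t.
Proof.
rewrite /subdiv (_ : [set v in permute p t]%SET = [set v in t]%SET); last first.
  by apply/setP => v; rewrite !inE (perm_mem (perm_eq_permute p t)).
rewrite (perm_all _ (perm_eq_permute p t)); case: ifP => _; last by rewrite mulr0.
have -> : coord_mx T (permute p t) = row_perm p (coord_mx T t).
  by apply/matrixP => i j; rewrite !mxE tnth_mktuple.
by rewrite row_permE detM det_perm sgzM; congr (_ * _); case: odd_perm; rewrite /= ?expr0 ?expr1 ?sgzN ?sgz1.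
Qed.

(** A wall is a simplex [w] of [X] inside [T], of codimension one in [T]. *)

Section Wall.
Variables (r : nat) (T : seq J) (w : r.+1.-tuple V).
Hypotheses (sizeT : size T = r.+2) (uniqT : uniq T).
Hypothesis TK : [set p in T]%SET \in join_complex k m.
Hypotheses (wX : [set v in w]%SET \in simp X) (uniqw : uniq w).
Hypothesis wT : all (supported T) w.

(** The signed maximal minors of the coordinate matrix of the wall, which form a
  normal vector of the hyperplane that it spans. *)
Definition normal (j : 'I_r.+2) : R := (-1) ^+ j * \det (coord_mx (omit j T) w).

(** A multiple of the signed distance to the hyperplane of the wall. *)
Definition height (x : 'M[R]_((Zp_trunc k).+2, m)) : R :=
  \sum_(j < r.+2) entry x (nth p0 T j) * normal j.

(** The coordinate matrix of [x] followed by the wall; [x] may be any point, so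
  that [height] can also be evaluated at the vertices of [T]. *)
Definition wall_mx (x : 'M[R]_((Zp_trunc k).+2, m)) : 'M[R]_r.+2 :=
  \matrix_(i, j) entry (if unlift ord0 i is Some i' then pos (tnth w i') else x) (nth p0 T j).

Lemma wall_mx_cons v : wall_mx (pos v) = coord_mx T (tcons v w).
Proof.
apply/matrixP => i j; rewrite !mxE.
case: unliftP => [i'|] ->; last by rewrite [tnth (tcons v w) ord0]tnth0.
by congr (entry (pos _) _); rewrite tnthS.
Qed.

Lemma det_wall_mx x : \det (wall_mx x) = height x.
Proof.
rewrite (expand_det_row _ ord0); apply: eq_bigr => j _.
rewrite mxE unlift_none; congr (_ * _); rewrite /cofactor add0n /normal.
congr (_ * \det _); apply/matrixP => i l; rewrite !mxE liftK nth_omit //.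
by rewrite sizeT.
Qed.

Lemma height_sum (I : Type) (s : seq I) (P : pred I) (a : I -> R) F :
  height (\sum_(i <- s | P i) a i *: F i) = \sum_(i <- s | P i) a i * height (F i).
Proof.
rewrite /height; under eq_bigr => j _ do rewrite entry_sum mulr_suml.
rewrite exchange_big /=; apply: eq_bigr => i _; rewrite mulr_sumr.
by apply: eq_bigr => j _; rewrite mulrA.
Qed.

Lemma heightD x y : height (x + y) = height x + height y.
Proof. by rewrite /height -big_split; apply: eq_bigr => j _; rewrite /entry mxE mulrDl. Qed.

Lemma heightZ a x : height (a *: x) = a * height x.
Proof. by rewrite /height mulr_sumr; apply: eq_bigr => j _; rewrite /entry mxE mulrA. Qed.

Lemma height_wall i : height (pos (tnth w i)) = 0.
Proof.
rewrite -det_wall_mx; apply: (@determinant_alternate _ _ _ ord0 (lift ord0 i)) => //.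
by move=> j; rewrite !mxE unlift_none liftK.
Qed.

Lemma height_mem v : v \in w -> height (pos v) = 0.
Proof. by case/tnthP => i ->; apply: height_wall. Qed.

Definition corner (j : 'I_r.+2) : 'M[R]_((Zp_trunc k).+2, m) :=
  join_vertex R (nth p0 T j).

Lemma entry_corner j p : entry (corner j) p = (p == nth p0 T j)%:R.
Proof. by rewrite /entry mxE -pair_eqE. Qed.

Lemma entry_corner_nth j (l : 'I_r.+2) : entry (corner j) (nth p0 T l) = (l == j)%:R.
Proof. by rewrite entry_corner nth_uniq ?sizeT. Qed.

Lemma height_corner j : height (corner j) = normal j.
Proof.
rewrite /height (bigD1 j) //= entry_corner_nth eqxx mul1r big1 ?addr0 // => l /negPf nlj.
by rewrite entry_corner_nth nlj mul0r.
Qed.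

Lemma supported_mem i p : entry (pos (tnth w i)) p != 0 -> p \in T.
Proof. by apply/supportedP; apply: (allP wT); apply: mem_tnth. Qed.

Lemma supported_eq (x y : 'M[R]_((Zp_trunc k).+2, m)) : (forall p, entry x p != 0 -> p \in T) ->
  (forall p, entry y p != 0 -> p \in T) ->
  (forall j : 'I_r.+2, entry x (nth p0 T j) = entry y (nth p0 T j)) -> x = y.
Proof.
move=> xT yT eqxy; apply: entry_eq => p; have [pT|npT] := boolP (p \in T).
  have ltp : (index p T < r.+2)%N by rewrite -sizeT index_mem.
  by have := eqxy (Ordinal ltp); rewrite /= nth_index.
have -> : entry x p = 0 by apply/eqP; apply: contraR npT => /xT.
by apply/esym/eqP; apply: contraR npT => /yT.
Qed.

Lemma wall_free (a : 'I_r.+1 -> R) : \sum_i a i *: pos (tnth w i) = 0 -> forall i, a i = 0.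
Proof.
move=> a0 i; pose b v := if v \in w then a (inord (index v w)) else 0.
have bE j : b (tnth w j) = a j.
  by rewrite /b mem_tnth (tnth_nth (thead w)) index_uniq ?size_tuple // inord_val.
rewrite -bE; apply: (linear_independent wX); last by rewrite inE mem_tnth.
rewrite (eq_bigl (mem w)) => [|v]; last by rewrite inE.
rewrite -big_uniq //= big_tuple -[RHS]a0; apply: eq_bigr => j _.
by rewrite bE.
Qed.

(** The wall is linearly independent but too small to span, so that some vertex of
  [T] completes it to a basis and has a nonzero height. *)
Lemma normal_neq0 : exists j, normal j != 0.
Proof.
apply/existsP; apply: contraT; rewrite negb_exists => /forallP n0.
pose N : 'M[R]_(r.+1, r.+2) := \matrix_(i, j) entry (pos (tnth w i)) (nth p0 T j).
have freeN (u : 'rV[R]_r.+1) : u *m N = 0 -> u = 0.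
  move=> uN; apply/rowP => i; rewrite mxE.
  apply: (wall_free (a := fun i => u 0 i)) => {i}.
  apply: supported_eq => [p|p|j]; last first.
  - transitivity (0 : R); last by rewrite /entry mxE.
    have /rowP/(_ j) := uN; rewrite !mxE => <-; rewrite entry_sum.
    by apply: eq_bigr => i _; rewrite mxE.
  - by rewrite /entry mxE eqxx.
  - rewrite entry_sum; apply: contraR => pT; rewrite big1 // => i _.
    by rewrite (_ : entry _ p = 0) ?mulr0 //; apply/eqP; apply: contraR pT => /supported_mem.
have rN : \rank N = r.+1 by apply/eqP; apply: inj_row_free.
have : row_full N.
  rewrite -sub1mx; apply/row_subP => j.
  have := n0 j; rewrite negbK -height_corner -det_wall_mx => /det0P[u u0 uM].
  have E : u 0 ord0 *: row j 1%:M + (\row_i u 0 (lift ord0 i)) *m N = 0.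
    rewrite -[RHS]uM; apply/rowP => l; rewrite !mxE [RHS]big_ord_recl mxE unlift_none.
    rewrite entry_corner_nth [j == l]eq_sym; congr (_ + _); apply: eq_bigr => i _.
    by rewrite !mxE liftK.
  have nu : u 0 ord0 != 0.
    apply: contra u0 => /eqP u00; move: E; rewrite u00 scale0r add0r => /freeN uS.
    apply/eqP/rowP => i; rewrite mxE; case: (unliftP ord0 i) => [i'|] -> //.
    by have /rowP/(_ i') := uS; rewrite !mxE.
  have -> : row j 1%:M = (- (u 0 ord0)^-1 *: \row_i u 0 (lift ord0 i)) *m N.
    move/eqP: E; rewrite addrC addr_eq0 => /eqP E.
    by rewrite -scalemxAl E scaleNr scalerN opprK scalerA mulVf // scale1r.
  exact: submxMl.
by rewrite /row_full rN => /eqP /n_Sn.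
Qed.

(** A vertex of nonzero height completes the wall to a basis. *)
Lemma wall_span v x : supported T v -> height (pos v) != 0 ->
  (forall p, entry x p != 0 -> p \in T) ->
  exists a (b : 'I_r.+1 -> R), x = a *: pos v + \sum_i b i *: pos (tnth w i).
Proof.
move=> /supportedP vT hv xT.
have uM : wall_mx (pos v) \in unitmx by rewrite unitmxE det_wall_mx unitfE.
have [u uE] : exists u, u *m wall_mx (pos v) = \row_j entry x (nth p0 T j).
  by exists ((\row_j entry x (nth p0 T j)) *m invmx (wall_mx (pos v))); rewrite mulmxKV.
exists (u 0 ord0), (fun i => u 0 (lift ord0 i)).
apply: supported_eq => // [p|j].
  apply: contraR => pT; rewrite entryD entryZ entry_sum.
  rewrite [X in u _ _ * X](_ : _ = 0) ?mulr0 ?add0r; last by apply/eqP; apply: contraR pT => /vT.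
  rewrite big1 // => i _.
  by rewrite (_ : entry _ p = 0) ?mulr0 //; apply/eqP; apply: contraR pT => /supported_mem.
have /rowP/(_ j) := uE; rewrite [in RHS]mxE => <-.
rewrite [LHS]mxE [LHS]big_ord_recl entryD entryZ entry_sum.
congr (_ + _); first by rewrite [in LHS]mxE unlift_none.
by apply: eq_bigr => i _; rewrite mxE liftK.
Qed.

(** Two simplices on the same side of a wall overlap beyond it: a short move from
  the barycentre of the wall towards [u] stays in both of them.  If [u] and
  [v] were distinct, the simplices would only meet in the wall. *)
Lemma same_side_eq u v : supported T u -> supported T v ->
  [set y in tcons u w]%SET \in simp X -> [set y in tcons v w]%SET \in simp X ->
  0 < height (pos u) * height (pos v) -> u = v.
Proof.
move=> uT vT uX vX huv; apply/eqP; apply: contraT => nuv.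
have [hu hv] : height (pos u) != 0 /\ height (pos v) != 0.
  by split; apply: contraTneq huv => ->; rewrite ?mulr0 ?mul0r ltxx.
have [a [b uE]] := wall_span vT hv (elimT (supportedP _ _) uT).
have hE : height (pos u) = a * height (pos v).
  rewrite uE heightD heightZ height_sum big1 ?addr0 // => i _.
  by rewrite height_wall mulr0.
have a0 : 0 < a.
  by move: huv; rewrite hE -mulrA pmulr_lgt0 // lt_neqAle eq_sym mulf_neq0 //= -expr2 sqr_ge0.
(* so large that the weights [N + b i] of the second expansion are nonnegative *)
pose N := \sum_i `|b i|.
have N0 : 0 <= N by apply: sumr_ge0.
have Nb i : 0 <= N + b i.
  rewrite -(opprK (b i)) subr_ge0 (le_trans (ler_norm _)) // normrN.
  by rewrite /N (bigD1 i) //= lerDl sumr_ge0.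
pose c := 1 + N * r.+1%:R.
have c0 : 0 < c by rewrite ltr_pwDl // mulr_ge0.
pose q := c^-1 *: (pos u + \sum_i N *: pos (tnth w i)).
have hq : height q != 0.
  rewrite heightZ heightD height_sum big1 ?addr0 => [|i _]; last by rewrite height_wall mulr0.
  by rewrite mulf_neq0 // invr_eq0 gt_eqF.
have tconsE y (a0' : R) (b' : 'I_r.+1 -> R) :
    c^-1 *: (a0' *: pos y + \sum_i b' i *: pos (tnth w i)) =
    \sum_i (c^-1 * (if unlift ord0 i is Some i' then b' i' else a0')) *:
       pos (tnth (tcons y w) i).
  rewrite [RHS]big_ord_recl unlift_none tnth0 scalerDr scalerA; congr (_ + _).
  rewrite scaler_sumr; apply: eq_bigr => i _.
  by rewrite liftK tnthS scalerA.
have q1 : hull (@pos _ _ _ X) [set y in tcons u w]%SET q.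
  rewrite /q -{1}[pos u]scale1r tconsE; apply: hull_tuple.
  - by move=> i; rewrite mulr_ge0 ?invr_ge0 ?(ltW c0) //; case: unliftP.
  - rewrite -mulr_sumr big_ord_recl unlift_none.
    under eq_bigr => i _ do rewrite liftK.
    by rewrite sumr_const card_ord -[N *+ _]mulr_natr mulVf ?gt_eqF.
  - by move=> y yt; rewrite inE.
have sE : a + \sum_i (N + b i) = c.
  have : a + \sum_i b i = 1.
    rewrite -(entry_pos_sum u) uE [RHS](eq_bigr (fun p => a * entry (pos v) p +
      entry (\sum_i b i *: pos (tnth w i)) p)); last by move=> p _; rewrite entryD entryZ.
    by rewrite big_split -mulr_sumr entry_pos_sum mulr1 sum_entry_sum.
  by rewrite big_split /= sumr_const card_ord -[N *+ _]mulr_natr /c; lra.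
have q2 : hull (@pos _ _ _ X) [set y in tcons v w]%SET q.
  have -> : q = c^-1 *: (a *: pos v + \sum_i (N + b i) *: pos (tnth w i)).
    rewrite /q uE -addrA -big_split; congr (_ *: (_ + _)).
    by apply: eq_bigr => i _; rewrite scalerDl addrC.
  rewrite tconsE; apply: hull_tuple.
  - by move=> i; rewrite mulr_ge0 ?invr_ge0 ?(ltW c0) //; case: unliftP => [i' _|_]; [exact: Nb|exact: ltW].
  - rewrite -mulr_sumr big_ord_recl unlift_none.
    under eq_bigr => i _ do rewrite liftK.
    by rewrite sE mulVf ?gt_eqF //.
  - by move=> y yt; rewrite inE.
have [[_ _ _ capX] _ _] := simpP X.
have : (hull (@pos _ _ _ X) [set y in tcons u w]%SET `&`
        hull (@pos _ _ _ X) [set y in tcons v w]%SET)%classic q by [].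
rewrite capX // => -[g [_ _ qE]]; case/negP: hq; apply/eqP.
rewrite qE height_sum big1 // => y; rewrite !inE => /andP[].
case/predU1P => [->|/height_mem-> _]; last by rewrite mulr0.
by case/predU1P => [/eqP|/height_mem->]; rewrite ?(negPf nuv) ?mulr0.
Qed.

(** Up to a factor, the points of a segment from the barycentre of the wall
  towards a vertex of [T]; they approach the wall as [N] grows.  Without the
  factor they depend affinely on [N]. *)
Definition ray j (N : nat) := corner j + \sum_i N%:R *: pos (tnth w i).

Lemma ray_carrier j N : exists A, A \in simp X /\
  exists a : V -> R, (forall v, v \in A -> 0 < a v) /\
    ray j N = \sum_(v in A) a v *: pos v.
Proof.
pose c : R := 1 + N%:R * r.+1%:R.
have c0 : 0 < c by rewrite ltr_pwDl // mulr_ge0.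
have rayE p : entry (ray j N) p =
    (p == nth p0 T j)%:R + \sum_i N%:R * entry (pos (tnth w i)) p.
  by rewrite entryD entry_corner entry_sum.
have [||p|A [a [AX a0 aE]]] := @carrier _ _ _ X (c^-1 *: ray j N) _ TK.
- move=> p; rewrite entryZ rayE mulr_ge0 ?invr_ge0 ?(ltW c0) // addr_ge0 //.
  by apply: sumr_ge0 => i _; rewrite mulr_ge0 ?entry_pos_ge0.
- under eq_bigr => p _ do rewrite entryZ entryD.
  rewrite -mulr_sumr big_split sum_entry_sum sumr_const card_ord -[_ *+ r.+1]mulr_natr.
  rewrite (bigD1 (nth p0 T j)) //= entry_corner eqxx big1 => [|p /negPf np].
    by rewrite addr0 -/c mulVf ?gt_eqF.
  by rewrite entry_corner np.
- rewrite inE entryZ rayE; apply: contraR => pT.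
  rewrite big1 => [|i _]; last first.
    by rewrite (_ : entry _ p = 0) ?mulr0 //; apply/eqP; apply: contraR pT => /supported_mem.
  rewrite addr0; case: (p =P nth p0 T j) => [pE|_]; last by rewrite mulr0.
  by case/negP: pT; rewrite pE mem_nth ?sizeT.
exists A; split=> //; exists (fun v => c * a v); split=> [v vA|].
  by rewrite mulr_gt0 ?a0.
rewrite -[LHS]scale1r -(mulfV (x := c)) ?gt_eqF // -scalerA aE scaler_sumr.
by apply: eq_bigr => v _; rewrite scalerA.
Qed.

(** Finitely many simplices contain all these points, so that one of them contains
  points arbitrarily close to the wall. *)
Lemma ray_recurrent j : exists A, A \in simp X /\
  forall M, exists N, (M <= N)%N /\
  exists a : V -> R, (forall v, v \in A -> 0 < a v) /\
    ray j N = \sum_(v in A) a v *: pos v.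
Proof.
apply: contrapT => H.
have bnd A : exists M, A \in simp X -> forall N, (M <= N)%N ->
    ~ exists a : V -> R, (forall v, v \in A -> 0 < a v) /\
    ray j N = \sum_(v in A) a v *: pos v.
  apply: contrapT => HA; apply: H; exists A.
  have AX : A \in simp X by apply: contrapT => nAX; apply: HA; exists 0%N.
  split=> // M; apply: contrapT => HM; apply: HA; exists M => _ N leMN Ha.
  by apply: HM; exists N.
have [f Hf] := choice bnd.
have [A [AX HA]] := ray_carrier j (\max_A f A).
by apply: (Hf A AX) HA; apply: leq_bigmax.
Qed.

(** A simplex that contains points of the ray arbitrarily close to the wall
  contains its barycentre, hence the whole wall; and one of its vertices is on
  the side of the wall towards which the ray leaves. *)
Lemma other_side_exists j : normal j != 0 ->
  exists v, [/\ supported T v, [set y in tcons v w]%SET \in simp X &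
                0 < height (pos v) * normal j].
Proof.
move=> nj; have [A [AX rec]] := ray_recurrent j.
have [N1 [_ [a1 [a1p rE1]]]] := rec 0%N.
(* The weights depend affinely on [N], and their slope gives the sum of the wall. *)
have slope N2 a2 : (N1 < N2)%N -> ray j N2 = \sum_(v in A) a2 v *: pos v ->
    \sum_i 1 *: pos (tnth w i) = \sum_(v in A) ((a2 v - a1 v) / (N2 - N1)%:R) *: pos v.
  move=> lt12 rE2; have d0 : (N2 - N1)%:R != 0 :> R by rewrite pnatr_eq0 subn_eq0 -ltnNge.
  apply: (scalerI d0); rewrite !scaler_sumr.
  transitivity (ray j N2 - ray j N1).
    rewrite /ray opprD addrACA subrr add0r -sumrB; apply: eq_bigr => i _.
    by rewrite -scalerBl scalerA mulr1 natrB // ltnW.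
  rewrite rE2 rE1 -sumrB; apply: eq_bigr => v _.
  by rewrite scalerA mulrC divfK // scalerBl.
have [N2 [lt12 [a2 [_ rE2]]]] := rec N1.+1.
pose b v := (a2 v - a1 v) / (N2 - N1)%:R.
have wE : \sum_i 1 *: pos (tnth w i) = \sum_(v in A) b v *: pos v by apply: slope.
have b0 v : v \in A -> 0 <= b v.
  move=> vA; rewrite leNgt; apply/negP => bv.
  have [N3 [lt3 [a3 [a3p rE3]]]] := rec (N1 + (Num.bound (a1 v / - b v))).+1.
  have lt13 : (N1 < N3)%N by apply: leq_trans lt3; rewrite ltnS leq_addr.
  have d0 : 0 < (N3 - N1)%:R :> R by rewrite ltr0n subn_gt0.
  have eqb : (a3 v - a1 v) / (N3 - N1)%:R = b v.
    apply/eqP; rewrite -subr_eq0; apply/eqP.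
    apply: (linear_independent (a := fun v => (a3 v - a1 v) / (N3 - N1)%:R - b v) AX) => //.
    under eq_bigr => y _ do rewrite scalerBl.
    by rewrite sumrB -wE -(slope N3) // subrr.
  have a3E : a3 v = a1 v + (N3 - N1)%:R * b v.
    by rewrite -eqb mulrC divfK ?gt_eqF // addrC subrK.
  have := a3p v vA; rewrite a3E; apply/negP; rewrite -leNgt.
  have : a1 v / - b v <= (N3 - N1)%:R.
    apply: le_trans (ltW (archi_boundP _)) _.
      by rewrite mulr_ge0 ?ltW ?a1p // invr_gt0 oppr_gt0.
    by rewrite ler_nat; lia.
  by rewrite ler_pdivrMr ?oppr_gt0 // mulrN => h; lra.
have r0 : (r.+1%:R : R) != 0 by rewrite pnatr_eq0.
pose z := (r.+1%:R : R)^-1 *: \sum_i 1 *: pos (tnth w i).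
have zw : z = \sum_i (r.+1%:R)^-1 *: pos (tnth w i).
  by rewrite /z scaler_sumr; apply: eq_bigr => i _; rewrite scale1r.
have z1 : hull (@pos _ _ _ X) A z.
  exists (fun v => (r.+1%:R)^-1 * b v); split=> [v vA||].
  - by rewrite mulr_ge0 ?b0 // invr_ge0.
  - rewrite -mulr_sumr -(sum_entry_sum (X := X) (mem A) b id) -wE sum_entry_sum.
    by rewrite sumr_const card_ord mulVf.
  - by rewrite /z wE scaler_sumr; apply: eq_bigr => v _; rewrite scalerA.
have z2 : hull (@pos _ _ _ X) [set y in w]%SET z.
  rewrite zw; apply: hull_tuple => [i||y yw]; rewrite ?invr_ge0 ?inE //.
  by rewrite sumr_const card_ord -[_ *+ _]mulr_natr mulVf.
have [[_ _ _ capX] _ _] := simpP X.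
have : (hull (@pos _ _ _ X) A `&` hull (@pos _ _ _ X) [set y in w]%SET)%classic z by [].
rewrite capX // => -[g [_ _ zE]].
(* The barycentre is interior to the wall, so that all its vertices are in [A]. *)
have wA v : v \in w -> v \in A.
  move=> vw; apply: contraT => nvA.
  have : (if v \in A then g v else 0) - (r.+1%:R)^-1 = 0.
    apply: (linear_independent (a := fun v => (if v \in A then g v else 0) - (r.+1%:R)^-1) wX); last by rewrite inE.
    under eq_bigr => y _ do rewrite scalerBl.
    rewrite sumrB; apply/eqP; rewrite subr_eq0; apply/eqP.
    transitivity z.
      rewrite zE big_mkcond [RHS]big_mkcond; apply: eq_bigr => y _.
      by rewrite finset.in_setI; case: (y \in A); case: (y \in [set y in w]%SET); rewrite ?scale0r.
    rewrite zw (eq_bigl (mem w)) => [|y]; last by rewrite inE.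
    by rewrite -big_uniq //= big_tuple.
  by rewrite (negPf nvA) sub0r => /eqP; rewrite oppr_eq0 invr_eq0 (negPf r0).
have hE : \sum_(v in A) a1 v * (height (pos v) * normal j) = normal j ^+ 2.
  under eq_bigr => v _ do rewrite mulrA.
  rewrite -mulr_suml -height_sum -rE1 /ray heightD height_corner height_sum.
  by rewrite big1 ?addr0 // => i _; rewrite height_wall mulr0.
have [v vA hv] : exists2 v, v \in A & 0 < height (pos v) * normal j.
  apply/exists_inP; apply: contraT; rewrite negb_exists_in => /forall_inP nh.
  have : 0 < normal j ^+ 2 by rewrite lt_neqAle eq_sym sqrf_eq0 nj sqr_ge0.
  rewrite -hE ltNge sumr_le0 // => v vA.
  by apply: mulr_ge0_le0; [exact: ltW (a1p _ vA) | rewrite leNgt nh].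
exists v; split=> //.
  apply/supportedP => p vp; have := carrier_support a1p vA vp; rewrite -rE1.
  rewrite entryD entry_corner entry_sum; apply: contraR => pT.
  rewrite big1 => [|i _]; last first.
    by rewrite (_ : entry _ p = 0) ?mulr0 //; apply/eqP; apply: contraR pT => /supported_mem.
  by rewrite addr0; case: (p =P nth p0 T j) => // pE; rewrite pE mem_nth ?sizeT in pT.
apply: (simp_sub AX); last by apply/set0Pn; exists v; rewrite inE mem_head.
by apply/fintype.subsetP => y; rewrite !inE => /predU1P[->|/wA].
Qed.

Lemma mulr_gt0_trans (x y z : R) : 0 < x * y -> 0 < x * z -> 0 < y * z.
Proof.
move=> xy xz; have x2 : 0 < x ^+ 2.
  by rewrite exprn_even_gt0 //=; apply: contraTneq xy => ->; rewrite mul0r ltxx.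
by have := mulr_gt0 xy xz; rewrite mulrACA -expr2 pmulr_rgt0.
Qed.

(** The sign of [e] selects a side of the wall.  A neighbour on this side is unique
  by [same_side_eq], exists by [other_side_exists] if [T] has a vertex there,
  and cannot exist otherwise. *)
Lemma sum_one_side (e : R) :
  \sum_(v | [set y in tcons v w]%SET \in simp X)
     (supported T v && (0 < e * height (pos v))%R)%:R =
  [exists j, 0 < e * normal j]%R%:R :> int.
Proof.
case: existsP => [[j hj]|nh].
  have nj : normal j != 0 by apply: contraTneq hj => ->; rewrite mulr0 ltxx.
  have [v [vT vX hv]] := other_side_exists nj.
  have hev : 0 < e * height (pos v).
    by apply: (@mulr_gt0_trans (normal j)); rewrite mulrC.
  rewrite (bigD1 v) //= vT hev big1 ?addr0 // => u /andP[uX nuv].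
  case: andP => // -[uT heu]; case/eqP: nuv; apply: same_side_eq => //.
  exact: (mulr_gt0_trans heu hev).
rewrite big1 // => v vX; case: andP => // -[vT hv]; case: nh.
apply/existsP; apply: contraT; rewrite negb_exists => /forallP nh.
move: hv; rewrite ltNge mulr_sumr sumr_le0 // => j _.
by rewrite mulrCA mulr_ge0_le0 ?entry_pos_ge0 // leNgt nh.
Qed.

Lemma sgz_gt0_lt0 (x : R) : sgz x = (0 < 1 * x)%R%:R - (0 < -1 * x)%R%:R.
Proof. by rewrite mul1r mulN1r oppr_gt0; case: sgzP => // *; rewrite ?ltxx. Qed.

Lemma sum_subdiv_tcons :
  \sum_v subdiv T (tcons v w) =
  [exists j, 0 < 1 * normal j]%R%:R - [exists j, 0 < -1 * normal j]%R%:R.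
Proof.
rewrite -!sum_one_side -sumrB [RHS]big_mkcond; apply: eq_bigr => v _.
rewrite /subdiv; case: ifP => /= [/andP[-> /andP[-> _]]|].
  by rewrite -wall_mx_cons det_wall_mx sgz_gt0_lt0.
case: ifP => //= _; rewrite wT andbT => ->.
by rewrite subrr.
Qed.

(** If the wall lies in the facet opposite to the vertex [i] of [T], all other
  components of [normal] vanish, and the facet contributes the sign of this
  one.  If it lies in no facet, a point inside it has positive coordinates
  only, which forces [normal] to have components of both signs; then both sides
  are zero. *)
Lemma sum_subdiv_omit :
  \sum_(i < r.+2) subdiv (omit i T) w *~ (-1) ^+ i =
  [exists j, 0 < 1 * normal j]%R%:R - [exists j, 0 < -1 * normal j]%R%:R.
Proof.
have termE (i : 'I_r.+2) : subdiv (omit i T) w *~ (-1) ^+ i =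
    if all (supported (omit i T)) w then sgz (normal i) else 0.
  rewrite /subdiv wX /=; case: ifP => _; last by rewrite mul0rz.
  rewrite /normal sgzM mulrzz mulrC; congr (_ * _).
  by rewrite -signr_odd -[in RHS]signr_odd; case: odd; rewrite ?expr0 ?expr1 ?sgzN ?sgz1.
rewrite (eq_bigr _ (fun i _ => termE i)).
have [/existsP[i wi]|] := boolP [exists i : 'I_r.+2, all (supported (omit i T)) w].
  have n0 j : j != i -> normal j = 0.
    move=> nji; rewrite -height_corner -det_wall_mx (expand_det_col _ i) big1 // => l _.
    rewrite mxE; case: (unliftP ord0 l) => [l'|] _; last first.
      by rewrite entry_corner_nth eq_sym (negPf nji) mul0r.
    rewrite (_ : entry _ _ = 0) ?mul0r //; apply/eqP; apply: contraT.
    have /supportedP H := allP wi _ (mem_tnth l' w).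
    move/H => /(nthP p0)[q]; rewrite size_omit ?sizeT //= => ltq.
    rewrite nth_omit ?sizeT // => /eqP; rewrite nth_uniq ?sizeT //.
      by rewrite eq_sym (negPf (neq_bump _ _)).
    by rewrite /bump; case: (i <= q)%N => //=; lia.
  have ex e : [exists j, 0 < e * normal j] = (0 < e * normal i).
    apply/existsP/idP => [[j]|]; last by exists i.
    by have [-> //|/n0->] := eqVneq j i; rewrite mulr0 ltxx.
  rewrite (bigD1 i) //= wi big1 => [|j /n0->]; last by rewrite sgz0; case: ifP.
  by rewrite addr0 !ex sgz_gt0_lt0.
rewrite negb_exists => /forallP nall.
rewrite big1 => [|i _]; last by rewrite (negPf (nall i)).
pose x := \sum_i 1 *: pos (tnth w i).
have hx : \sum_(j < r.+2) entry x (nth p0 T j) * normal j = 0.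
  by rewrite -[LHS]/(height x) height_sum big1 // => i _; rewrite height_wall mulr0.
have x0 (j : 'I_r.+2) : 0 < entry x (nth p0 T j).
  have /allPn[v vw] := nall j.
  rewrite negb_forall => /existsP[p]; rewrite negb_imply => /andP[vp pj].
  have pT : p \in T by have /allP/(_ v vw)/supportedP := wT; apply.
  have pE : p = nth p0 T j.
    apply/eqP; apply: contraR pj => npj.
    have ltp : (index p T < r.+2)%N by rewrite -sizeT index_mem.
    have nij : j != Ordinal ltp by apply: contra npj => /eqP->; rewrite /= nth_index.
    have [q qE _] := unlift_some nij.
    apply/(nthP p0); exists q; rewrite ?size_omit ?nth_omit ?sizeT //=.
    have /(congr1 val) /= <- := qE; exact: nth_index.
  case/tnthP: vw vp => i -> vp.
  rewrite -pE entry_sum (bigD1 i) //= mul1r ltr_wpDr //.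
    by apply: sumr_ge0 => l _; rewrite mul1r entry_pos_ge0.
  by rewrite lt_neqAle eq_sym vp entry_pos_ge0.
(* A vector orthogonal to a positive one has components of both signs. *)
have both (e : R) : e != 0 -> [exists j, 0 < e * normal j].
  move=> e0; apply: contraT; rewrite negb_exists => /forallP ng.
  have [j nj] := normal_neq0.
  have /psumr_eq0P : \sum_(j < r.+2) entry x (nth p0 T j) * - (e * normal j) = 0.
    transitivity (- e * \sum_(j < r.+2) entry x (nth p0 T j) * normal j).
      by rewrite mulr_sumr; apply: eq_bigr => l _; rewrite mulrN mulrCA mulNr.
    by rewrite hx mulr0.
  move=> /(_ _)/(_ j erefl)/eqP; rewrite mulf_eq0 gt_eqF //= oppr_eq0 mulf_eq0.
  by rewrite (negPf e0) (negPf nj); apply=> l _; rewrite mulr_ge0 ?oppr_ge0 ?(ltW (x0 l)) // leNgt ng.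
by rewrite !both ?subrr // ?oppr_eq0 oner_eq0.
Qed.

End Wall.

(** Subdivision commutes with the boundary.  The sum on the left counts the
  neighbours of the wall with sign, that on the right the facets of [T] that
  contain it; [sum_subdiv_tcons] and [sum_subdiv_omit] give them the same
  value. *)
Lemma subdiv_boundary r (T : seq J) (w : r.+1.-tuple V) :
  size T = r.+2 -> uniq T -> [set p in T]%SET \in join_complex k m ->
  \sum_v subdiv T (tcons v w) = alt (fun T' => subdiv T' w) T.
Proof.
move=> sizeT uniqT TK; rewrite altE.
rewrite -(big_mkord xpredT (fun i => subdiv (omit i T) w *~ (-1) ^+ i)) sizeT big_mkord.
have [wX|nwX] := boolP ([set v in w]%SET \in simp X); last first.
  rewrite !big1 // => [i _|v _]; rewrite /subdiv.
    by rewrite (negPf nwX) mul0rz.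
  case: ifP => // /andP[vX _]; case/negP: nwX; apply: (simp_sub vX).
    by apply/fintype.subsetP => u; rewrite !inE => ->; rewrite orbT.
  by apply/set0Pn; exists (thead w); rewrite inE mem_tnth.
have [wT|nwT] := boolP (all (supported T) w); last first.
  rewrite !big1 // => [i _|v _]; rewrite /subdiv.
    case: ifP => [/andP[_ wi]|_]; last by rewrite mul0rz.
    case/negP: nwT; apply: sub_all wi => v /supportedP H; apply/supportedP => p /H.
    by rewrite /omit mem_cat => /orP[/mem_take|/mem_drop].
  by case: ifP => // /and3P[_ _ wT]; case/negP: nwT.
have [uw|nuw] := boolP (uniq w); first by rewrite sum_subdiv_tcons // sum_subdiv_omit.
rewrite !big1 // => [i _|v _].
  by apply/eqP; apply: contraR nuw => h; apply: (@subdiv_uniq (omit i T)); apply: contra h => /eqP->; rewrite mul0rz.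
by apply/eqP; apply: contraR nuw => /subdiv_uniq /andP[].
Qed.

End SubdivisionOperator.

(** * The generalized sphere in the join *)

Section ModelSphere.
Variables (k n : nat).
Hypothesis k_ge2 : (2 <= k)%N.
Notation J := ('Z_k * 'I_n.+1)%type.
Implicit Types (S : seq J) (G : seq J -> int) (h : 'Z_k).

Definition apex (i : nat) : J := (1%g, inord i).
Definition simplex_act h S : seq J := [seq ((h * p.1)%g, p.2) | p <- S].

(** The value of the cochain [G] at the [r]-th chain of a generalized sphere in the
  join: a vertex if [r] is zero, and otherwise the cone with apex [apex r] over
  the image of the preceding chain under [tau] or [sigma].  The cochains are
  defined on ordered simplices, with the apex in front. *)
Fixpoint model_pairing (r : nat) (G : seq J -> int) : int :=
  if r is r'.+1 then
    \sum_h resolution_coef k r h * model_pairing r' (fun S => G (apex r :: simplex_act h S))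
  else G [:: apex 0].

Lemma model_pairing_ext r G G' : G =1 G' -> model_pairing r G = model_pairing r G'.
Proof.
elim: r G G' => [|r IHr] G G' eqG //=; apply: eq_bigr => h _.
by congr (_ * _); apply: IHr => S.
Qed.

Lemma model_pairing_sum r (I : Type) (s : seq I) (P : pred I) (a : I -> int)
    (G : I -> seq J -> int) :
  model_pairing r (fun S => \sum_(i <- s | P i) a i * G i S) =
  \sum_(i <- s | P i) a i * model_pairing r (G i).
Proof.
elim: r G => [|r IHr] G //=.
under eq_bigr => h _ do rewrite IHr mulr_sumr.
rewrite exchange_big /=; apply: eq_bigr => i _; rewrite mulr_sumr.
by apply: eq_bigr => h _; rewrite mulrCA.
Qed.

Lemma model_pairingZ r a G : model_pairing r (fun S => a * G S) = a * model_pairing r G.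
Proof.
have := model_pairing_sum r [:: tt] xpredT (fun=> a) (fun=> G); rewrite big_seq1 => <-.
by apply: model_pairing_ext => S; rewrite big_seq1.
Qed.

Lemma model_pairingB r G G' :
  model_pairing r (fun S => G S - G' S) = model_pairing r G - model_pairing r G'.
Proof.
have := model_pairing_sum r [:: true; false] xpredT (fun b : bool => if b then 1 else -1)
  (fun b => if b then G else G').
rewrite !big_cons big_nil mul1r mulN1r addr0 => <-; apply: model_pairing_ext => S.
by rewrite !big_cons big_nil mul1r mulN1r addr0.
Qed.

Lemma simplex_actM h h' S : simplex_act h (simplex_act h' S) = simplex_act (h * h')%g S.
Proof. by rewrite /simplex_act -map_comp; apply: eq_map => p /=; rewrite mulgA. Qed.

Lemma resolution_coefM r : resolution_coef k r.+1 * resolution_coef k r = 0.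
Proof. by rewrite /resolution_coef /=; case: odd => /=; rewrite 1?[sigma k * _]mulrC tau_sigma. Qed.

Lemma augmentation_tau : \sum_h tau k h = 0.
Proof.
have := augmentationD (tau k) 1; rewrite /tau subrK -gelt1 !augmentation_gelt // /augmentation.
by move/eqP; rewrite -subr_eq subrr eq_sym => /eqP.
Qed.

(** The boundary of the cone over a cycle is this cycle.  The base of the cone is
  indeed a cycle: its own boundary carries a factor [tau * sigma], which is
  zero. *)
Lemma model_pairing_alt r G :
  model_pairing r.+1 (alt G) =
  \sum_h resolution_coef k r.+1 h * model_pairing r (fun S => G (simplex_act h S)).
Proof.
have step r' :
    (forall G', \sum_h resolution_coef k r'.+1 h *
       model_pairing r' (fun S => alt G' (simplex_act h S)) = 0) ->
    forall H, model_pairing r'.+1 (alt H) =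
      \sum_h resolution_coef k r'.+1 h * model_pairing r' (fun S => H (simplex_act h S)).
  move=> cycle H.
  rewrite /= (eq_bigr (fun h =>
    resolution_coef k r'.+1 h * model_pairing r' (fun S => H (simplex_act h S)) -
    resolution_coef k r'.+1 h *
      model_pairing r' (fun S => alt (fun w => H (apex r'.+1 :: w)) (simplex_act h S)))).
    by rewrite sumrB cycle subr0.
  by move=> h _; rewrite -mulrBr model_pairingB.
apply: (step r) => {G}; elim: r => [|r IHr] G'.
  by rewrite /= -mulr_suml subr0 augmentation_tau mul0r.
rewrite (eq_bigr (fun h => \sum_h' (resolution_coef k r.+2 h * resolution_coef k r.+1 h') *
    model_pairing r (fun S => G' (simplex_act (h * h')%g S)))) => [|h _]; last first.
  rewrite (@model_pairing_ext _ _ (alt (fun S => G' (simplex_act h S)))); last first.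
    by move=> S; rewrite alt_map.
  rewrite (step r IHr) mulr_sumr; apply: eq_bigr => h' _; rewrite mulrA; congr (_ * _).
  by apply: model_pairing_ext => S; rewrite simplex_actM.
(* collecting the terms with the same product [h * h'] *)
rewrite (eq_bigr (fun h => \sum_g resolution_coef k r.+2 h * resolution_coef k r.+1 (h^-1 * g)%g *
    model_pairing r (fun S => G' (simplex_act g S)))) => [|h _]; last first.
  rewrite [RHS](reindex_inj (mulgI h)) /=.
  by apply: eq_bigr => h' _; rewrite mulKg.
rewrite exchange_big /= big1 // => g _; rewrite -mulr_suml.
have /ffunP/(_ g) := resolution_coefM r.+1; rewrite !ffunE => ->; exact: mul0r.
Qed.

(** The pairs of vertices that occur in a simplex of the generalized sphere.  On
  the levels [2i] and [2i + 1] these are the edges of a cycle of length [2k],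
  in which [(s, 2i + 1)] is adjacent to [(s, 2i)] and to [(g * s, 2i)]. *)
Definition compatible (p q : J) : bool :=
  ((p.2 == q.2) ==> (p.1 == q.1)) &&
  ((odd p.2 && (p.2 == q.2.+1 :> nat)) ==> ((q.1 == p.1) || (q.1 == gen k * p.1)%g)).

(** The simplices that support the [r]-th chain, one vertex on each level. *)
Definition model_simplex (r : nat) S : Prop :=
  [/\ map (fun p : J => p.2 : nat) S = rev (iota 0 r.+1), (head (apex r) S).1 = 1%g &
      {in S &, forall p q, compatible p q}].

Lemma resolution_coef_odd r h : odd r -> resolution_coef k r h != 0 -> (h == 1%g) || (h == gen k).
Proof.
move=> or; rewrite /resolution_coef or /tau -gelt1 !ffunE; apply: contraR.
by rewrite negb_or => /andP[/negPf-> /negPf->].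
Qed.

Lemma rev_iotaS r : rev (iota 0 r.+1) = r :: rev (iota 0 r).
Proof. by rewrite -[r.+1]addn1 iotaD rev_cat. Qed.

(** Between an odd level and the one below, the factor [tau] only leaves the
  translations by [e] and [g] to the base of the cone. *)
Lemma model_simplexS r h S : (r.+1 <= n)%N -> model_simplex r S ->
  resolution_coef k r.+1 h != 0 -> model_simplex r.+1 (apex r.+1 :: simplex_act h S).
Proof.
move=> ltrn [lev hd comp] coefh.
have inr : (inord r.+1 : 'I_n.+1) = r.+1 :> nat by rewrite inordK.
have levS q : q \in S -> (q.2 <= r)%N.
  by move/(map_f (fun p : J => p.2 : nat)); rewrite lev mem_rev mem_iota.
split=> //.
  rewrite rev_iotaS -lev; congr (_ :: _); first exact: inr.
  by rewrite -[LHS]/(map (fun p : J => p.2 : nat) _) /simplex_act -map_comp.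
have apexq q : q \in S -> compatible (apex r.+1) (h * q.1, q.2)%g.
  move=> qS; rewrite /compatible /= inr -val_eqE /= inr.
  rewrite gtn_eqF ?ltnS ?levS //=; apply/implyP => /andP[or /eqP[eqr]].
  have -> : q.1 = 1%g.
    rewrite -hd; case: (S) lev comp qS => [|p S'] //.
    rewrite rev_iotaS => -[pr _] comp qS.
    have := comp p q (mem_head _ _) qS; rewrite /compatible => /andP[/implyP/(_ _)/eqP-> //].
    by apply/eqP/val_inj; rewrite /= pr.
  by rewrite !mulg1; apply: resolution_coef_odd coefh.
have qapex q : q \in S -> compatible (h * q.1, q.2)%g (apex r.+1).
  move=> qS; rewrite /compatible /= inr -val_eqE /= inr.
  have leqr := levS _ qS; rewrite ltn_eqF ?ltnS //=.
  by rewrite [_ == r.+2]ltn_eqF ?andbF // !ltnS ltnW ?ltnS.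
move=> p q; rewrite !inE => /predU1P[->|/mapP[p' p'S ->]] /predU1P[->|/mapP[q' q'S ->]] /=.
- by rewrite /compatible !eqxx /= ltn_eqF ?andbF.
- exact: apexq.
- exact: qapex.
have := comp _ _ p'S q'S; rewrite /compatible /= !(inj_eq (mulgI h)).
have -> : (gen k * (h * p'.1) = h * (gen k * p'.1))%g.
  by rewrite !mulgA; congr (_ * _)%g; apply: (addrC (gen k)).
by rewrite (inj_eq (mulgI h)).
Qed.

Lemma model_pairing_supp r G G' : (r <= n)%N ->
  (forall S, model_simplex r S -> G S = G' S) -> model_pairing r G = model_pairing r G'.
Proof.
elim: r G G' => [|r IHr] G G' lern eqG /=.
  apply: eqG; split=> //=; first by rewrite inordK.
  by move=> p q; rewrite !inE => /eqP-> /eqP->; rewrite /compatible !eqxx ltn_eqF ?andbF.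
apply: eq_bigr => h _; have [->|coefh] := eqVneq (resolution_coef k r.+1 h) 0; first by rewrite !mul0r.
congr (_ * _); apply: IHr => [|S okS]; first exact: ltnW.
by apply: eqG; apply: model_simplexS.
Qed.

Lemma model_simplex_size r S : model_simplex r S -> size S = r.+1.
Proof. by case=> [/(congr1 size)]; rewrite size_map size_rev size_iota. Qed.

Lemma model_simplex_uniq r S : model_simplex r S -> uniq S.
Proof. by case=> lev _ _; apply: (@map_uniq _ _ (fun p : J => p.2 : nat)); rewrite lev rev_uniq iota_uniq. Qed.

Lemma model_simplex_join r S : model_simplex r S -> [set p in S]%SET \in join_complex k n.+1.
Proof.
move=> okS; have [lev hd comp] := okS; rewrite inE; apply/andP; split.
  apply/set0Pn; exists (head (apex r) S); rewrite inE.
  by case: (S) (model_simplex_size okS) => //= p S' _; rewrite mem_head.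
apply/forall_inP => p; rewrite inE => pS; apply/forall_inP => q; rewrite inE => qS.
apply/implyP => eq2; have /andP[/implyP/(_ eq2)/eqP eq1 _] := comp _ _ pS qS.
by rewrite [p]surjective_pairing [q]surjective_pairing eq1 (eqP eq2).
Qed.

End ModelSphere.

(** * The generalized sphere in a subdivision *)

Section SphereChains.
Variables (R : realType) (k n : nat) (X : equivariant_subdivision R k n.+1).
Hypothesis k_ge2 : (2 <= k)%N.
Notation J := ('Z_k * 'I_n.+1)%type.
Notation V := (vert X).

(** A default value for the entries of a sequence of vertices. *)
Definition origin : J := (1%g, ord0).

Definition sphere_chain (r : nat) : chain V r :=
  [ffun t => model_pairing r (fun S : seq J => subdiv origin S t)].

Lemma entry_act h (v : V) p : entry (pos (act h v)) p = entry (pos v) (h^-1 * p.1, p.2)%g.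
Proof. by rewrite actP /entry mxE. Qed.

Lemma simp_act h (A : {set V}) : (act h @: A \in simp X) = (A \in simp X).
Proof.
apply/idP/idP => [hA|]; last exact: act_simp.
have := act_simp h^-1%g hA; rewrite -imset_comp (_ : [set _ | x in A]%SET = A) //.
by rewrite -[RHS]imset_id; apply: eq_imset => v; rewrite /= vertex_actK.
Qed.

Lemma subdiv_simplex_act r h (S : seq J) (t : r.+1.-tuple V) : size S = r.+1 ->
  subdiv origin (simplex_act h S) t = subdiv origin S (tact (@act _ _ _ X) h^-1%g t).
Proof.
move=> sizeS; rewrite /subdiv.
have -> : [set v in tact (@act _ _ _ X) h^-1%g t]%SET = act h^-1%g @: [set v in t]%SET.
  by apply/setP => v; rewrite inE; apply/mapP/imsetP => -[u ut ->]; exists u => //; rewrite inE in ut *.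
rewrite simp_act all_map.
have -> : all (preim (act h^-1%g) (supported S)) t = all (supported (simplex_act h S)) t.
  apply: eq_all => v /=; apply/supportedP/supportedP => H p.
    move=> vp; have /H pS : entry (pos (act h^-1%g v)) (h^-1 * p.1, p.2)%g != 0.
      by rewrite entry_act invgK /= mulKVg -surjective_pairing.
    by apply/mapP; exists (h^-1 * p.1, p.2)%g => //=; rewrite mulKVg -surjective_pairing.
  rewrite entry_act invgK => /H /mapP[q qS E].
  have /mulgI eq1 : (h * p.1 = h * q.1)%g := congr1 fst E.
  by rewrite [p]surjective_pairing eq1 [p.2](congr1 snd E) -surjective_pairing.
case: ifP => // _; congr (sgz (\det _)); apply/matrixP => i j.
rewrite !mxE tnth_map entry_act invgK /= (nth_map origin) ?sizeS //=.
Qed.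

Lemma sphere_chain_supp r t : (r <= n)%N -> sphere_chain r t != 0 ->
  exists2 S, model_simplex r S & subdiv origin S t != 0.
Proof.
move=> lern; rewrite ffunE => nz; apply: contrapT => H; case/negP: nz.
rewrite (@model_pairing_supp _ _ r _ (fun S => 0 * 0)) //; first by rewrite model_pairingZ mul0r.
move=> S okS; rewrite mul0r; apply/eqP; apply: contraT => nz.
by case: H; exists S.
Qed.

Lemma sphere_chainP (Y : {set {set V}}) r : (r <= n)%N ->
  (forall S (t : r.+1.-tuple V), model_simplex r S -> [set v in t]%SET \in simp X ->
     all (supported S) t -> [set v in t]%SET \in Y) ->
  in_chains Y (sphere_chain r).
Proof.
move=> lern inY; split=> [p t|t /(sphere_chain_supp lern)[S okS nz]].
  by rewrite !ffunE -model_pairingZ; apply: model_pairing_ext => S; rewrite subdiv_permute.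
split; first exact: subdiv_uniq nz.
by move: nz; rewrite /subdiv; case: ifP => // /andP[tX tS] _; apply: inY tX tS.
Qed.

Lemma sphere_chain_in r : (r <= n)%N -> in_chains (simp X) (sphere_chain r).
Proof. by move=> lern; apply: sphere_chainP. Qed.

(** Subdivision is an equivariant chain map, so that the equations of the chains
  of the join carry over. *)
Lemma sphere_chain_boundary r : (r < n)%N ->
  boundary (sphere_chain r.+1) = chain_act (resolution_coef k r.+1) (sphere_chain r).
Proof.
move=> ltrn; apply/ffunP => w; rewrite (boundaryE _ (sphere_chain_in ltrn)) ffunE.
transitivity (model_pairing r.+1 (alt (fun S : seq J => subdiv origin S w))).
  transitivity (model_pairing r.+1 (fun S : seq J => \sum_v 1 * subdiv origin S (tcons v w))).
    by rewrite model_pairing_sum; apply: eq_bigr => v _; rewrite ffunE mul1r.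
  apply: model_pairing_supp => // S okS.
  rewrite -subdiv_boundary ?(model_simplex_size okS) ?(model_simplex_uniq okS) //.
    by apply: eq_bigr => v _; rewrite mul1r.
  exact: model_simplex_join okS.
rewrite model_pairing_alt //; apply: eq_bigr => h _; rewrite ffunE; congr (_ * _).
apply: model_pairing_supp => [|S okS]; first exact: ltnW.
by rewrite subdiv_simplex_act ?(model_simplex_size okS).
Qed.

Lemma sphere_chain_generalized : generalized_sphere n sphere_chain.
Proof. by split=> [i|i]; [apply: sphere_chain_in | apply: sphere_chain_boundary]. Qed.

(** The carrier of a vertex of the join lies over this vertex, hence is a vertex. *)
Lemma apex_vertex : exists v0 : V, pos v0 = join_vertex R (apex k n 0).
Proof.
have eE q : entry (join_vertex R (apex k n 0)) q = (q == apex k n 0)%:R.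
  by rewrite /entry mxE -pair_eqE.
have BK : [set apex k n 0]%SET \in join_complex k n.+1.
  rewrite inE; apply/andP; split; first by apply/set0Pn; exists (apex k n 0); rewrite set11.
  apply/forall_inP => p /set1P->; apply/forall_inP => q /set1P->.
  by rewrite !eqxx.
have [|||A [a [AX a0 aE]]] := @carrier _ _ _ X (join_vertex R (apex k n 0)) _ BK.
- by move=> p; rewrite eE ler0n.
- by rewrite (bigD1 (apex k n 0)) //= eE eqxx big1 ?addr0 // => p /negPf np; rewrite eE np.
- by move=> p; rewrite eE inE; case: (p == _); rewrite ?eqxx.
have [v vA] : exists v, v \in A.
  apply/set0Pn; apply: contraTneq AX => ->; by have [] := simp_complex X.
exists v; apply: entry_eq => p; rewrite eE.
have v0 q : q != apex k n 0 -> entry (pos v) q = 0.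
  move=> nq; apply/eqP; apply: contraR nq => /(carrier_support a0 vA).
  by rewrite -aE eE; case: (q == _); rewrite ?eqxx.
have [->|/v0//] := eqVneq p (apex k n 0).
by rewrite mulr1n -(entry_pos_sum v) [RHS](bigD1 (apex k n 0)) //= big1 ?addr0.
Qed.

Lemma augmentation_sphere_chain0 (l : V -> 'Z_k * nat) :
  augmentation (fr (hl l (sphere_chain 0))) = 1.
Proof.
have [v0 v0E] := apex_vertex; rewrite fr_hl /lin_ext.
have chainE v : sphere_chain 0 [tuple v] = (v == v0)%:R.
  rewrite ffunE /= /subdiv.
  have -> : [set u in [tuple v]]%SET = [set v]%SET by apply/setP => u; rewrite !inE.
  have [[_ vX _ _] _ _] := simpP X; rewrite vX /= andbT.
  have eE q : entry (pos v0) q = (q == apex k n 0)%:R.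
    by rewrite v0E /entry mxE -pair_eqE.
  have [->|nv] := eqVneq v v0.
    rewrite (_ : supported _ _ = true); last first.
      by apply/supportedP => p; rewrite eE inE; case: (p == _); rewrite ?eqxx.
    by rewrite det_mx11 mxE /= [tnth _ _]/= (tnth_nth v0) /= eE eqxx sgz1.
  case: ifP => // /supportedP H; case/eqP: nv; apply: (@vertex_pos_inj _ _ _ X).
  have v1 q : q != apex k n 0 -> entry (pos v) q = 0.
    by move=> nq; apply/eqP; apply: contraR nq => /H; rewrite inE.
  apply: entry_eq => p; rewrite eE; have [->|/v1//] := eqVneq p (apex k n 0).
  by rewrite mulr1n -(entry_pos_sum v) [RHS](bigD1 (apex k n 0)) //= big1 ?addr0.
rewrite (bigD1 [tuple v0]) //= [X in _ + X]big1 => [|t /andP[_ nt]]; last first.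
  have [v tE] : exists v, t = [tuple v] by case/tupleP: t {nt} => v t'; exists v; rewrite tuple0; apply: val_inj.
  move: nt; rewrite tE chainE; have [->|_ _] := eqVneq v v0; first by move/eqP.
  by rewrite mulr0z.
rewrite addr0 (_ : sphere_chain 0 _ = 1); last by have := chainE v0; rewrite (eqxx v0).
rewrite mulr1z fpattern_sorted // /fsymb /= /fbar /= /fbar_even.
rewrite (_ : strongly_alternating _ = true) ?mulr1 ?augmentation_gelt //.
by apply/forallP => -[].
Qed.

End SphereChains.

(** * The fan of a regular polygon *)

Section Polygon.
Variables (R : realType) (k : nat).
Hypothesis k_ge2 : (2 <= k)%N.
Implicit Types (z : int) (a b x y : R).

Let theta : R := pi / k%:R.

(** The vertices of a regular polygon with [2k] vertices, indexed by integers. *)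
Definition cos_dir z : R := cos (z%:~R * theta).
Definition sin_dir z : R := sin (z%:~R * theta).

Let theta_k : k%:R * theta = pi.
Proof. by rewrite mulrC divfK // pnatr_eq0 -lt0n ltnW. Qed.

Let theta_gt0 : 0 < theta.
Proof. by rewrite divr_gt0 ?pi_gt0 // ltr0n ltnW. Qed.

Lemma sin_dirN z : sin_dir (- z) = - sin_dir z.
Proof. by rewrite /sin_dir mulrNz mulNr sinN. Qed.

Lemma sin_dirDk z : sin_dir (z + k%:Z) = - sin_dir z.
Proof. by rewrite /sin_dir mulrzDr mulrDl theta_k sinDpi. Qed.

Lemma cos_dirDk z : cos_dir (z + k%:Z) = - cos_dir z.
Proof. by rewrite /cos_dir mulrzDr mulrDl theta_k cosDpi. Qed.

Lemma sin_dirB z z' : sin_dir (z - z') = sin_dir z * cos_dir z' - cos_dir z * sin_dir z'.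
Proof. by rewrite /sin_dir mulrzBr mulrBl sinB. Qed.

(** The sign of [sin_dir (q - p)] tells on which side of the line through the
  origin and the vertex [p] the vertex [q] lies. *)
Lemma sin_dir_ge0 z : 0 <= z <= k%:Z -> 0 <= sin_dir z.
Proof.
move=> /andP[z0 zk]; apply: sin_ge0_pi; rewrite mulr_ge0 ?ler0z ?(ltW theta_gt0) //=.
by rewrite -theta_k ler_pM2r // -[k%:R]/(k%:Z%:~R) ler_int.
Qed.

Lemma sin_dir1_gt0 : 0 < sin_dir 1.
Proof.
apply: sin_gt0_pi; rewrite mul1r theta_gt0 /= -theta_k -{1}[theta]mul1r.
by rewrite ltr_pM2r // ltr1n.
Qed.

Lemma sin_dir0 : sin_dir 0 = 0.
Proof. by rewrite /sin_dir mul0r sin0. Qed.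

Lemma sin_dir_le0 z : k%:Z <= z <= k%:Z + k%:Z -> sin_dir z <= 0.
Proof.
move=> /andP[zk z2k]; rewrite -[z](subrK k%:Z) sin_dirDk oppr_le0; apply: sin_dir_ge0.
by apply/andP; split; lia.
Qed.

(** The determinant of the vertex [z] of the polygon and the vector [(x, y)]. *)
Definition cross z x y : R := cos_dir z * y - sin_dir z * x.

(** The piecewise linear function of [(x, y)] which is one at the vertex [p], zero
  at the other vertices and linear on the cone over each edge.  On the two cones
  at [p] it is the smaller one of two linear forms, each of which vanishes at a
  neighbour of [p]; on all other cones one of the forms is nonpositive. *)
Definition hat (p : nat) x y : R :=
  Num.max 0 (Num.min (cross (p%:Z - 1) x y) (- cross (p%:Z + 1) x y)) / sin_dir 1.

Definition cone_x (q : nat) a b : R := a * cos_dir q + b * cos_dir q.+1.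
Definition cone_y (q : nat) a b : R := a * sin_dir q + b * sin_dir q.+1.

Lemma cross_cone z q a b :
  cross z (cone_x q a b) (cone_y q a b) = a * sin_dir (q%:Z - z) + b * sin_dir (q%:Z - z + 1).
Proof.
rewrite (_ : q%:Z - z + 1 = q.+1%:Z - z); last by rewrite -addn1 PoszD; ring.
by rewrite !sin_dirB /cross /cone_x /cone_y; ring.
Qed.

Let hat_num z a b := Num.max 0 (Num.min (a * sin_dir (z + 1) + b * sin_dir (z + 2))
                                  (- (a * sin_dir (z - 1) + b * sin_dir z))).

(** The value only depends on the difference of [q] and [p] modulo [2k], and a
  representative of it between [-1] and [2k - 2] determines all signs. *)
Lemma hat_cone p q a b : (p < k.*2)%N -> (q < k.*2)%N -> 0 <= a -> 0 <= b ->
  hat p (cone_x q a b) (cone_y q a b) =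
  if p == q then a else if p == (q.+1 %% k.*2)%N then b else 0.
Proof.
move=> ltp ltq a0 b0.
have s1 := sin_dir1_gt0; have s1N : sin_dir 1 != 0 by rewrite gt_eqF.
have s2 : 0 <= sin_dir 2 by apply: sin_dir_ge0; apply/andP; split; lia.
have period z : sin_dir (z + k.*2%:Z) = sin_dir z.
  by rewrite -addnn PoszD addrA !sin_dirDk opprK.
pose z := q%:Z - p%:Z.
have -> : hat p (cone_x q a b) (cone_y q a b) = hat_num z a b / sin_dir 1.
  rewrite /hat !cross_cone /hat_num /z; congr (Num.max _ (Num.min _ _) / _).
    by congr (_ * sin_dir _ + _ * sin_dir _); ring.
  by congr (- (_ * sin_dir _ + _ * sin_dir _)); ring.
(* [hat_num (q - p)] is the numerator of the value at [p] in the cone [q]. *)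
have shift (y : int) : hat_num (y + k.*2%:Z) a b = hat_num y a b.
  by rewrite /hat_num (addrAC y _ 1) (addrAC y _ 2) (addrAC y _ (-1)) !period.
have at0 : hat_num 0 a b = a * sin_dir 1.
  rewrite /hat_num add0r sub0r sin_dir0 mulr0 addr0 sin_dirN mulrN opprK.
  by rewrite min_r ?lerDl ?mulr_ge0 // max_r // mulr_ge0 // ltW.
have atN1 : hat_num (-1) a b = b * sin_dir 1.
  rewrite /hat_num addNr sin_dir0 mulr0 add0r (_ : -1 + 2 = 1) // (_ : -1 - 1 = -2) //.
  rewrite !sin_dirN !mulrN -opprD opprK min_l ?lerDr ?mulr_ge0 //.
  by rewrite max_r // mulr_ge0 // ltW.
have at_mid (y : int) : 1 <= y <= k.*2%:Z - 2 -> hat_num y a b = 0.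
  move=> /andP[y1 yk]; apply/max_idPl; rewrite ge_min.
  have [leyk|ltky] := lerP y k%:Z.
    apply/orP; right; rewrite oppr_le0 addr_ge0 // mulr_ge0 // sin_dir_ge0 //.
      by apply/andP; split; lia.
    by apply/andP; split; lia.
  apply/orP; left; rewrite -oppr_ge0 opprD -!mulrN addr_ge0 // mulr_ge0 // oppr_ge0 sin_dir_le0 //.
    by apply/andP; split; lia.
  by apply/andP; split; lia.
have [epq|npq] := eqVneq p q.
  by rewrite (_ : z = 0) ?at0 ?mulfK // /z epq subrr.
have [epq|npq1] := eqVneq p (q.+1 %% k.*2)%N.
  have [ltq1|geq1] := ltnP q.+1 k.*2.
    rewrite modn_small // in epq.
    by rewrite (_ : z = -1) ?atN1 ?mulfK // /z epq; lia.
  have eq1 : q.+1 = k.*2 by lia.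
  rewrite eq1 modnn in epq.
  by rewrite (_ : z = -1 + k.*2%:Z) ?shift ?atN1 ?mulfK // /z epq -eq1; lia.
have npq1' : z != -1 /\ z != k.*2%:Z - 1.
  have [ltq1|geq1] := ltnP q.+1 k.*2.
    by move: npq1; rewrite modn_small // /z => /eqP ?; split; apply/eqP; lia.
  have eq1 : q.+1 = k.*2 by lia.
  by move: npq1; rewrite eq1 modnn /z => /eqP ?; split; apply/eqP; lia.
case: npq1' => /eqP n1 /eqP n2; move/eqP in npq.
have [z0|z0] := lerP 1 z.
  by rewrite at_mid ?mul0r // z0 /=; move: n1 n2; rewrite /z; lia.
by rewrite -shift at_mid ?mul0r //; apply/andP; move: n1 n2 z0; rewrite /z; split; lia.
Qed.

(** The determinant with the [q]-th vertex changes its sign in every half turn, so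
  that it does between two consecutive vertices; by Cramer's rule the vector
  lies in the cone that they span. *)
Lemma in_some_cone x y : exists q a b, [/\ (q < k.*2)%N, 0 <= a, 0 <= b,
  x = cone_x q a b & y = cone_y q a b].
Proof.
have s1 := sin_dir1_gt0.
have [q ltq /andP[dq dq1]] : exists2 q, (q < k.*2)%N & (0 <= cross q x y) && (cross q.+1 x y <= 0).
  have antip z : cross (z + k%:Z) x y = - cross z x y.
    by rewrite /cross cos_dirDk sin_dirDk; ring.
  have ivt (p : nat) : 0 <= cross p x y ->
      exists2 i, (i < k)%N & (0 <= cross (p + i)%N x y) && (cross (p + i).+1 x y <= 0).
    move=> dp; apply: contrapT => H.
    have pos i : (i <= k)%N -> 0 <= cross (p + i)%N x y.
      elim: i => [|i IHi] leik; first by rewrite addn0.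
      rewrite addnS leNgt; apply/negP => lt0; apply: H; exists i => //.
      by rewrite IHi ?(ltnW leik) // ltW.
    have k1 : k.-1.+1 = k by rewrite prednK // ltnW.
    apply: H; exists k.-1; first by rewrite k1.
    by rewrite pos ?leq_pred // -addnS k1 PoszD antip oppr_le0.
  have [d0|/ltW d0] := lerP 0 (cross 0%N x y).
    by have [i lti] := ivt 0%N d0; rewrite add0n; exists i => //; lia.
  have [|i lti] := ivt k; first by rewrite -[k%:Z]add0r antip oppr_ge0.
  by exists (k + i)%N => //; lia.
exists q, (- cross q.+1 x y / sin_dir 1), (cross q x y / sin_dir 1).
have s1N : sin_dir 1 != 0 by rewrite gt_eqF.
have e1 : sin_dir 1 = sin_dir q.+1 * cos_dir q - cos_dir q.+1 * sin_dir q.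
  by rewrite -sin_dirB; congr sin_dir; lia.
split=> //; rewrite ?divr_ge0 ?oppr_ge0 ?(ltW s1) //.
  rewrite /cone_x; apply: (mulIf s1N); rewrite mulrDl [X in _ = X + _]mulrAC [X in _ = _ + X]mulrAC !divfK //.
  by rewrite {1}e1 /cross; ring.
rewrite /cone_y; apply: (mulIf s1N); rewrite mulrDl [X in _ = X + _]mulrAC [X in _ = _ + X]mulrAC !divfK //.
by rewrite {1}e1 /cross; ring.
Qed.

End Polygon.

(** * Unrolling the join of cycles *)

Section ConeSphere.
Variables (R : realType) (k n : nat).
Hypothesis k_ge2 : (2 <= k)%N.
Notation J := ('Z_k * 'I_n.+1)%type.
Notation M := 'M[R]_((Zp_trunc k).+2, n.+1).
Implicit Types (x : M) (y : 'rV[R]_n.+1) (s : 'Z_k).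

(** On a last level that is not part of a pair only two points are kept. *)
Definition tip (p : J) : bool :=
  ((p.2 == n :> nat) && ~~ odd n) ==> ((p.1 == 1%g) || (p.1 == gen k)).

(** The cone over the join of the cycles and, possibly, of the two points. *)
Definition model_cone x : Prop :=
  (forall p, 0 <= entry x p) /\
  (forall p q, entry x p != 0 -> entry x q != 0 -> compatible p q && tip p).

Definition col_at x (i : nat) s : R := x s (inord i).

Definition plane_x x i : R :=
  \sum_s (col_at x i s * cos_dir R k s.*2 + col_at x i.+1 s * cos_dir R k s.*2.+1).
Definition plane_y x i : R :=
  \sum_s (col_at x i s * sin_dir R k s.*2 + col_at x i.+1 s * sin_dir R k s.*2.+1).

(** The linear map that sends the cycle on each pair of levels to the regular
  polygon in a plane of its own, and the two points of an unpaired level to the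
  numbers [1] and [-1]. *)
Definition unroll x : 'rV[R]_n.+1 := \row_j
  if odd j then plane_y x j.-1 else if (j < n)%N then plane_x x j
  else x (1%g : 'Z_k) j - x (gen k) j.

(** The inverse of [unroll] on the cone: the coefficients of a vector in the fan of
  the polygon are its values under the hat functions. *)
Definition roll y : M := \matrix_(s, j)
  if odd j then hat k s.*2.+1 (y 0 (inord j.-1)) (y 0 j)
  else if (j < n)%N then hat k s.*2 (y 0 j) (y 0 (inord j.+1))
  else if s == 1%g :> 'Z_k then Num.max 0 (y 0 j)
  else if s == gen k :> 'Z_k then Num.max 0 (- y 0 j) else 0.

(** Weights [a] and [b] at the ends of the edge [q] of the cycle of length [2k].
  The position [2s] is that of the vertex [s] of the even level, and [2s + 1]
  that of the vertex [s] of the odd level. *)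
Definition edge_fun (q : nat) (a b : R) (p : nat) : R :=
  if p == q then a else if p == (q.+1 %% k.*2)%N then b else 0.

Let ltZ s : (s < k)%N. Proof. by rewrite -[X in (_ < X)%N](Zp_cast k_ge2) ltn_ord. Qed.

Lemma val_gen_mul s : (gen k * s)%g = (s.+1 %% k)%N :> nat.
Proof. by rewrite /= modnDml add1n [X in (_ %% X)%N](Zp_cast k_ge2). Qed.

Lemma double_gen_mul s : ((gen k * s)%g : 'Z_k).*2 = (s.*2.+2 %% k.*2)%N.
Proof. by rewrite val_gen_mul -!muln2 muln_modl mulSn. Qed.

Lemma sum_edge_fun (f : nat -> R) q a b : (q < k.*2)%N ->
  f (q.+1 %% k.*2)%N = f q.+1 ->
  \sum_(s : 'Z_k) (edge_fun q a b s.*2 * f s.*2 + edge_fun q a b s.*2.+1 * f s.*2.+1) =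
  a * f q + b * f q.+1.
Proof.
move=> ltq fq.
have dbl (F : nat -> R) m : \sum_(i < m) (F i.*2 + F i.*2.+1) = \sum_(i < m.*2) F i.
  elim: m => [|m IHm]; first by rewrite !big_ord0.
  by rewrite big_ord_recr /= IHm doubleS !big_ord_recr /= addrA.
have kE : (Zp_trunc k).+2 = k by apply: Zp_cast.
rewrite (dbl (fun p => edge_fun q a b p * f p)) kE.
have nq : (q.+1 %% k.*2)%N != q.
  have [ltq1|geq1] := ltnP q.+1 k.*2; first by rewrite modn_small // gtn_eqF.
  by rewrite (_ : q.+1 = k.*2) ?modnn; lia.
have ltq1 : (q.+1 %% k.*2 < k.*2)%N by rewrite ltn_mod double_gt0 ltnW.
rewrite (bigD1 (Ordinal ltq)) //= (bigD1 (Ordinal ltq1)) //=.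
rewrite big1 => [|i /andP[]]; last first.
  by rewrite -!val_eqE /edge_fun => /= /negPf-> /negPf->; rewrite mul0r.
by rewrite addr0 /edge_fun eqxx (negPf nq) eqxx fq.
Qed.

Lemma periodic_cos_dir q : (q < k.*2)%N -> cos_dir R k (q.+1 %% k.*2)%N = cos_dir R k q.+1.
Proof.
move=> ltq; have [ltq1|geq1] := ltnP q.+1 k.*2; first by rewrite modn_small.
have -> : q.+1 = k.*2 by lia.
by rewrite modnn (_ : k.*2%:Z = 0 + k%:Z + k%:Z) ?cos_dirDk ?opprK //; lia.
Qed.

Lemma periodic_sin_dir q : (q < k.*2)%N -> sin_dir R k (q.+1 %% k.*2)%N = sin_dir R k q.+1.
Proof.
move=> ltq; have [ltq1|geq1] := ltnP q.+1 k.*2; first by rewrite modn_small.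
have -> : q.+1 = k.*2 by lia.
by rewrite modnn (_ : k.*2%:Z = 0 + k%:Z + k%:Z) ?sin_dirDk ?opprK //; lia.
Qed.

Lemma plane_edge x i q a b : (q < k.*2)%N ->
  (forall s, col_at x i s = edge_fun q a b s.*2) ->
  (forall s, col_at x i.+1 s = edge_fun q a b s.*2.+1) ->
  plane_x x i = cone_x k q a b /\ plane_y x i = cone_y k q a b.
Proof.
move=> ltq xi xi1; split.
  rewrite /cone_x -(sum_edge_fun (f := fun p => cos_dir R k p) _ _ ltq (periodic_cos_dir ltq)).
  by apply: eq_bigr => s _; rewrite xi xi1.
rewrite /cone_y -(sum_edge_fun (f := fun p => sin_dir R k p) _ _ ltq (periodic_sin_dir ltq)).
by apply: eq_bigr => s _; rewrite xi xi1.
Qed.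

(** Compatibility confines the support on a pair of levels to an edge. *)
Lemma model_cone_edge x i : model_cone x -> ~~ odd i -> (i < n)%N ->
  exists q a b, [/\ (q < k.*2)%N, 0 <= a, 0 <= b,
    forall s, col_at x i s = edge_fun q a b s.*2 &
    forall s, col_at x i.+1 s = edge_fun q a b s.*2.+1].
Proof.
move=> [x0 xc] ei ltin.
have vi : (inord i : 'I_n.+1) = i :> nat by rewrite inordK // ltnW.
have vi1 : (inord i.+1 : 'I_n.+1) = i.+1 :> nat by rewrite inordK.
have same s t j : x s (inord j) != 0 -> x t (inord j) != 0 -> t = s.
  move=> xs xt; have /andP[/andP[/implyP H _] _] := xc (s, inord j) (t, inord j) xs xt.
  by have /eqP /= -> := H (eqxx _).
have next s t : x s (inord i.+1) != 0 -> x t (inord i) != 0 -> (t == s) || (t == gen k * s)%g.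
  move=> xs xt; have /andP[/andP[_ /implyP H] _] := xc (s, inord i.+1) (t, inord i) xs xt.
  by apply: H; rewrite /= vi vi1 eqxx /= ei.
have dblE s (t : 'Z_k) : (s.*2 == t.*2)%N = (s == t) by rewrite -!muln2 eqn_pmul2r.
have dblN s (t : 'Z_k) : (s.*2.+1 == t.*2) = false by apply/eqP => /(congr1 odd); rewrite /= !odd_double.
have dblN' s (t : 'Z_k) : (s.*2 == t.*2.+1) = false by rewrite eq_sym dblN.
have lt2 s : (s.*2.+1 < k.*2)%N by rewrite -doubleS leq_double ltZ.
have lt2' s : (s.*2 < k.*2)%N by rewrite ltn_double ltZ.
(* a vertex [s] of the even level, joined to the vertex [s] of the odd level *)
have even_edge s : (forall t, t != s -> x t (inord i) = 0) ->
    (forall t, t != s -> x t (inord i.+1) = 0) ->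
    exists q a b, [/\ (q < k.*2)%N, 0 <= a, 0 <= b,
    forall s, col_at x i s = edge_fun q a b s.*2 &
    forall s, col_at x i.+1 s = edge_fun q a b s.*2.+1].
  move=> ev od; exists s.*2, (x s (inord i)), (x s (inord i.+1)).
  split=> //; try exact: (x0 (s, _)).
    move=> t; rewrite /col_at /edge_fun modn_small // dblE dblN'.
    by case: eqVneq => [->|/ev].
  move=> t; rewrite /col_at /edge_fun modn_small // dblN eqSS dblE.
  by case: eqVneq => [->|/od].
have [/existsP[s xs]|] := boolP [exists s : 'Z_k, x s (inord i.+1) != 0]; last first.
  rewrite negb_exists => /forallP odd0.
  have od t : x t (inord i.+1) = 0 by apply/eqP/negPn; apply: odd0.
  have [/existsP[s xs]|] := boolP [exists s : 'Z_k, x s (inord i) != 0].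
    apply: (even_edge s) => // t nts; apply/eqP; apply: contraR nts => xt.
    by apply/eqP; apply: same xs xt.
  rewrite negb_exists => /forallP ev0; apply: (even_edge 1%g) => // t _.
  by apply/eqP/negPn; apply: ev0.
have od t : t != s -> x t (inord i.+1) = 0.
  by move=> nts; apply/eqP; apply: contraR nts => xt; apply/eqP; apply: same xs xt.
have [gs0|xgs] := eqVneq (x (gen k * s)%g (inord i)) 0.
  apply: (even_edge s) => // t nts; apply/eqP; apply: contraR nts => xt.
  by case/orP: (next _ _ xs xt) => // /eqP tE; rewrite tE gs0 eqxx in xt.
have ev t : t != (gen k * s)%g -> x t (inord i) = 0.
  by move=> nts; apply/eqP; apply: contraR nts => xt; apply/eqP; apply: same xgs xt.
exists s.*2.+1, (x s (inord i.+1)), (x (gen k * s)%g (inord i)).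
split=> //; try exact: (x0 (_, _)).
  move=> t; rewrite /col_at /edge_fun -double_gen_mul dblN' dblE.
  by case: eqVneq => [->|/ev].
move=> t; rewrite /col_at /edge_fun -double_gen_mul dblN eqSS dblE.
by case: eqVneq => [->|/od].
Qed.

Lemma col_atE x s (j : 'I_n.+1) : col_at x j s = x s j.
Proof. by rewrite /col_at inord_val. Qed.

Lemma gen_neq1 : gen k != 1%g.
Proof. by []. Qed.

Lemma hat_edge_fun (p q : nat) a b : (p < k.*2)%N -> (q < k.*2)%N -> 0 <= a -> 0 <= b ->
  hat k p (cone_x k q a b) (cone_y k q a b) = edge_fun q a b p.
Proof. exact: hat_cone. Qed.

Lemma lt_even s : (s.*2 < k.*2)%N. Proof. by rewrite ltn_double ltZ. Qed.
Lemma lt_odd s : (s.*2.+1 < k.*2)%N. Proof. by rewrite -doubleS leq_double ltZ. Qed.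

Lemma unroll_planes x i : ~~ odd i -> (i < n)%N ->
  unroll x 0 (inord i) = plane_x x i /\ unroll x 0 (inord i.+1) = plane_y x i.
Proof.
by move=> ei ltin; rewrite !mxE !inordK ?ltnS ?(ltnW ltin) //= ei (negPf ei) ltin.
Qed.

Lemma roll_hats y i s : ~~ odd i -> (i < n)%N ->
  col_at (roll y) i s = hat k s.*2 (y 0 (inord i)) (y 0 (inord i.+1)) /\
  col_at (roll y) i.+1 s = hat k s.*2.+1 (y 0 (inord i)) (y 0 (inord i.+1)).
Proof.
by move=> ei ltin; rewrite /col_at !mxE !inordK ?ltnS ?(ltnW ltin) //= ei (negPf ei) ltin.
Qed.

(** Columns come in pairs, up to the last one if their number is odd. *)
Lemma column_ind (P : 'I_n.+1 -> Prop) :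
  (forall i, ~~ odd i -> (i < n)%N -> P (inord i)) ->
  (forall i, ~~ odd i -> (i < n)%N -> P (inord i.+1)) ->
  (~~ odd n -> P ord_max) -> forall j, P j.
Proof.
move=> Plow Phigh Plast j; have := ltn_ord j; rewrite ltnS => lejn.
have [oj|ej] := boolP (odd j).
  have jE : j.-1.+1 = j by case: (j : nat) oj.
  rewrite -[j]inord_val -jE; apply: Phigh; last by rewrite jE.
  by move: oj; rewrite -{1}jE.
have [ltjn|gejn] := ltnP j n; first by rewrite -[j]inord_val; apply: Plow.
have jn : j = n :> nat by apply/eqP; rewrite eqn_leq lejn.
by have -> : j = ord_max; [apply: val_inj | apply: Plast; rewrite -jn].
Qed.

Lemma unroll_last x : ~~ odd n -> unroll x 0 ord_max = x (1%g : 'Z_k) ord_max - x (gen k) ord_max.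
Proof. by move=> en; rewrite mxE /= (negPf en) ltnn. Qed.

Lemma roll_last y s : ~~ odd n -> roll y s ord_max =
  if s == 1%g :> 'Z_k then Num.max 0 (y 0 ord_max)
  else if s == gen k :> 'Z_k then Num.max 0 (- y 0 ord_max) else 0.
Proof. by move=> en; rewrite mxE /= (negPf en) ltnn. Qed.

Lemma unrollK x : model_cone x -> roll (unroll x) = x.
Proof.
move=> xc; apply/matrixP => s; apply: column_ind => [i ei ltin|i ei ltin|en].
- have [q [a [b [ltq a0 b0 xi xi1]]]] := model_cone_edge xc ei ltin.
  rewrite -[LHS]/(col_at (roll _) i s) (roll_hats _ _ ei ltin).1.
  rewrite (unroll_planes _ ei ltin).1 (unroll_planes _ ei ltin).2.
  have [-> ->] := plane_edge ltq xi xi1.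
  by rewrite hat_edge_fun // ?lt_even // -xi.
- have [q [a [b [ltq a0 b0 xi xi1]]]] := model_cone_edge xc ei ltin.
  rewrite -[LHS]/(col_at (roll _) i.+1 s) (roll_hats _ _ ei ltin).2.
  rewrite (unroll_planes _ ei ltin).1 (unroll_planes _ ei ltin).2.
  have [-> ->] := plane_edge ltq xi xi1.
  by rewrite hat_edge_fun // ?lt_odd // -xi1.
have [x0 comp] := xc.
have same t u : x t ord_max != 0 -> x u ord_max != 0 -> t = u.
  move=> xt xu; have /andP[/andP[/implyP H _] _] := comp (t, ord_max) (u, ord_max) xt xu.
  by have /eqP /= -> := H (eqxx _).
have xt t : t != 1%g -> t != gen k -> x t ord_max = 0.
  move=> nt1 ntg; apply/eqP; apply: contraT => nz.
  have /andP[_] := comp (t, ord_max) (t, ord_max) nz nz.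
  by rewrite /tip /= eqxx en /= (negPf nt1) (negPf ntg).
rewrite roll_last // unroll_last //.
have z0 t : 0 <= x t ord_max := x0 (t, ord_max).
have [g0|g0] := eqVneq (x (gen k) ord_max) 0.
  rewrite g0 subr0; have [->|ns1] := eqVneq s 1%g; first by rewrite max_r.
  have [->|nsg] := eqVneq s (gen k); last by rewrite xt.
  by rewrite max_l ?oppr_le0 // g0.
have e0 : x 1%g ord_max = 0.
  apply/eqP; apply: contraT => nz; have := gen_neq1; by rewrite (same _ _ g0 nz) eqxx.
rewrite e0 sub0r opprK; have [->|ns1] := eqVneq s 1%g; first by rewrite max_l ?oppr_le0.
have [->|nsg] := eqVneq s (gen k); last by rewrite xt.
by rewrite max_r.
Qed.

Lemma roll_edge y i : ~~ odd i -> (i < n)%N -> exists q a b,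
  [/\ (q < k.*2)%N, y 0 (inord i) = cone_x k q a b, y 0 (inord i.+1) = cone_y k q a b,
      forall s, col_at (roll y) i s = edge_fun q a b s.*2 &
      forall s, col_at (roll y) i.+1 s = edge_fun q a b s.*2.+1].
Proof.
move=> ei ltin.
have [q [a [b [ltq a0 b0 yi yi1]]]] := in_some_cone k_ge2 (y 0 (inord i)) (y 0 (inord i.+1)).
exists q, a, b; split=> // s.
  by rewrite (roll_hats _ _ ei ltin).1 yi yi1 hat_edge_fun ?lt_even.
by rewrite (roll_hats _ _ ei ltin).2 yi yi1 hat_edge_fun ?lt_odd.
Qed.

Lemma rollK y : unroll (roll y) = y.
Proof.
apply/rowP; apply: column_ind => [i ei ltin|i ei ltin|en].
- have [q [a [b [ltq -> _ xi xi1]]]] := roll_edge y ei ltin.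
  by rewrite (unroll_planes _ ei ltin).1 (plane_edge ltq xi xi1).1.
- have [q [a [b [ltq _ -> xi xi1]]]] := roll_edge y ei ltin.
  by rewrite (unroll_planes _ ei ltin).2 (plane_edge ltq xi xi1).2.
rewrite unroll_last // !roll_last // eqxx (negPf gen_neq1) eqxx.
by rewrite /Num.max; case: ltP => ?; case: ltP => ?; lra.
Qed.

Lemma edge_fun_neq0 (q p : nat) a b : edge_fun q a b p != 0 ->
  p = q \/ p = (q.+1 %% k.*2)%N.
Proof.
rewrite /edge_fun; have [->|_] := eqVneq p q; first by left.
by have [->|_] := eqVneq p (q.+1 %% k.*2)%N; [right | rewrite eqxx].
Qed.

Lemma odd_next (q : nat) : odd (q.+1 %% k.*2)%N = ~~ odd q.
Proof. by rewrite odd_mod ?odd_double. Qed.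

Lemma roll_ge0 y s j : 0 <= roll y s j.
Proof.
rewrite mxE; have h p u v : 0 <= hat k p u v :> R.
  by rewrite /hat mulr_ge0 ?le_max ?lexx // invr_ge0 ltW // sin_dir1_gt0.
by do 4?[case: ifP => _]; rewrite ?h ?le_max ?lexx.
Qed.

Lemma roll_model_cone y : model_cone (roll y).
Proof.
split=> [p|]; first exact: roll_ge0.
have dblI s (t : 'Z_k) : s.*2 = t.*2 -> s = t.
  by move/double_inj => eqst; apply: val_inj.
have parity (q p p' : nat) a b : edge_fun q a b p != 0 -> edge_fun q a b p' != 0 ->
    odd p = odd p' -> p = p'.
  move=> /edge_fun_neq0[]-> /edge_fun_neq0[]-> //; rewrite odd_next.
    by case: odd.
  by case: odd.
have same s t j : roll y s j != 0 -> roll y t j != 0 -> s = t.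
  move: j; apply: column_ind => [i ei ltin|i ei ltin|en].
  - have [q [a [b [_ _ _ xi _]]]] := roll_edge y ei ltin.
    rewrite -[roll y s _]/(col_at _ i s) -[roll y t _]/(col_at _ i t) !xi => es et.
    by apply: dblI; apply: parity es et _; rewrite !odd_double.
  - have [q [a [b [_ _ _ _ xi]]]] := roll_edge y ei ltin.
    rewrite -[roll y s _]/(col_at _ i.+1 s) -[roll y t _]/(col_at _ i.+1 t) !xi => es et.
    by apply/dblI/eq_add_S; apply: parity es et _; rewrite /= !odd_double.
  have side u : roll y u ord_max != 0 ->
      u = 1%g /\ 0 < y 0 ord_max \/ u = gen k /\ y 0 ord_max < 0.
    rewrite roll_last // /Num.max; have [->|_] := eqVneq u 1%g.
      by case: ltP => [|_]; [left | rewrite eqxx].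
    have [->|_] := eqVneq u (gen k); last by rewrite eqxx.
    by rewrite oppr_gt0; case: ltP => [|_]; [right | rewrite eqxx].
  by move=> /side[] [-> ys] /side[] [-> yt] //; have := lt_trans ys yt; rewrite ltxx.
move=> [s j] [t j'] /= xs xt; rewrite /entry /= in xs xt.
apply/andP; split.
  apply/andP; split; apply/implyP => /=.
    by move=> /eqP ejj; rewrite ejj in xs; rewrite (same _ _ _ xs xt).
  case/andP => oj /eqP jj'.
  have ej' : ~~ odd j' by move: oj; rewrite jj'.
  have ltj' : (j' < n)%N by rewrite -ltnS -jj' ltn_ord.
  have [q [a [b [_ _ _ xi xi1]]]] := roll_edge y ej' ltj'.
  have xs' : edge_fun q a b s.*2.+1 != 0.
    by rewrite -xi1 /col_at -jj' inord_val.
  have xt' : edge_fun q a b t.*2 != 0 by rewrite -xi col_atE.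
  case/edge_fun_neq0: xs' => sE; case/edge_fun_neq0: xt' => tE.
  - by have := congr1 odd sE; rewrite -tE /= !odd_double.
  - by apply/orP; right; apply/eqP/dblI; rewrite double_gen_mul tE -sE.
  - apply/orP; left; apply/eqP/dblI; move: sE; rewrite -tE modn_small ?lt_odd //.
    by case.
  - by have := congr1 odd sE; rewrite -tE /= !odd_double.
rewrite /tip /=; apply/implyP => /andP[/eqP jn en].
have jE : j = ord_max by apply: val_inj.
move: xs; rewrite jE roll_last //; case: (s == 1%g) => //=.
by case: (s == gen k); rewrite ?eqxx.
Qed.

End ConeSphere.

(** * The join of cycles is a sphere *)

Section Continuity.
Local Open Scope classical_set_scope.
Variables (R : realType) (T : topologicalType).

Lemma continuous_sum (I : Type) (r : seq I) (P : pred I) (f : I -> T -> R) (x : T) :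
  (forall i, {for x, continuous (f i)}) ->
  {for x, continuous (fun t => \sum_(i <- r | P i) f i t)}.
Proof.
move=> fc; elim: r => [|i r IHr].
  have -> : (fun t => \sum_(i <- [::] | P i) f i t) = cst 0.
    by apply/funext => t; rewrite big_nil.
  exact: cst_continuous.
have -> : (fun t => \sum_(j <- i :: r | P j) f j t) =
          (fun t => (if P i then f i t else 0) + \sum_(j <- r | P j) f j t).
  by apply/funext => t; rewrite big_cons; case: ifP => // _; rewrite add0r.
apply: (@continuousD _ _ _ (fun t => if P i then f i t else 0)) => //.
by case: (P i); [apply: fc | apply: cst_continuous].
Qed.

(** The neighbourhoods of a matrix are given entry by entry, and there are finitely
  many entries. *)
Lemma continuous_matrix m n (f : T -> 'M[R]_(m, n)) (x : T) :
  (forall i j, {for x, continuous (fun t => f t i j)}) -> {for x, continuous f}.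
Proof.
move=> fc A [P PA sPA].
have : \forall t \near x, forall ij : 'I_m * 'I_n, P ij.1 ij.2 (f t ij.1 ij.2).
  by apply: filter_forall => -[i j]; apply: fc; apply: PA.
by apply: filterS => t Pt; apply: sPA => i j; apply: (Pt (i, j)).
Qed.

End Continuity.

Section Homeomorphism.
Variables (R : realType) (k n : nat).
Hypothesis k_ge2 : (2 <= k)%N.
Notation J := ('Z_k * 'I_n.+1)%type.
Notation M := 'M[R]_((Zp_trunc k).+2, n.+1).
Notation V := 'rV[R]_n.+1.
Implicit Types (x : M) (y : V).

Definition mass x : R := \sum_p entry x p.
Definition norm2 y : R := Num.sqrt (\sum_i y 0 i ^+ 2).

Lemma unrollZ (a : R) x : unroll (k := k) (a *: x) = a *: unroll x.
Proof.
have sumZ i (f g : 'Z_k -> R) :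
    \sum_s (col_at (a *: x) i s * f s + col_at (a *: x) i.+1 s * g s) =
    a * \sum_s (col_at x i s * f s + col_at x i.+1 s * g s).
  rewrite mulr_sumr; apply: eq_bigr => s _; rewrite /col_at !mxE.
  by rewrite mulrDr !mulrA.
apply/rowP => j; rewrite !mxE /plane_x /plane_y !sumZ.
by do 2?[case: ifP => // _]; rewrite mulrBr.
Qed.

Lemma model_coneZ (a : R) x : 0 <= a -> model_cone x -> model_cone (a *: x).
Proof.
move=> a0 [x0 xc]; split=> [p|p q]; rewrite !entryZ; first by rewrite mulr_ge0.
by rewrite !mulf_eq0 !negb_or => /andP[_ xp] /andP[_ xq]; apply: xc.
Qed.

Lemma massZ (a : R) x : mass (a *: x) = a * mass x.
Proof. by rewrite /mass mulr_sumr; apply: eq_bigr => p _; rewrite entryZ. Qed.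

Lemma norm2Z (a : R) y : 0 <= a -> norm2 (a *: y) = a * norm2 y.
Proof.
move=> a0; rewrite /norm2 -[in RHS](ger0_norm a0) -sqrtr_sqr -sqrtrM ?sqr_ge0 //.
by congr Num.sqrt; rewrite mulr_sumr; apply: eq_bigr => i _; rewrite mxE exprMn.
Qed.

Lemma norm2_gt0 y : y != 0 -> 0 < norm2 y.
Proof.
move=> y0; rewrite sqrtr_gt0 lt_neqAle sumr_ge0 => [|i _]; last exact: sqr_ge0.
rewrite andbT eq_sym; apply: contra y0 => /eqP /psumr_eq0P H.
apply/eqP/rowP => i; rewrite mxE; apply/eqP; rewrite -sqrf_eq0 H // => j _.
exact: sqr_ge0.
Qed.

Lemma sphereE y : sphere R n y <-> norm2 y = 1.
Proof.
rewrite /sphere /norm2 /=; split=> [->|]; first exact: sqrtr1.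
move=> h; rewrite -[LHS]sqr_sqrtr ?h ?expr1n //.
by apply: sumr_ge0 => i _; apply: sqr_ge0.
Qed.

Lemma unroll0 : unroll (k := k) (0 : M) = 0.
Proof. by rewrite -(scale0r (0 : M)) unrollZ scale0r. Qed.

Lemma model_cone0 : model_cone (0 : M).
Proof.
by rewrite -(scale0r (roll k (0 : V))); apply: model_coneZ => //; apply: roll_model_cone.
Qed.

Lemma roll0 : roll k (0 : V) = 0.
Proof. by rewrite -unroll0 unrollK //; apply: model_cone0. Qed.

Lemma mass_gt0 y : y != 0 -> 0 < mass (roll k y).
Proof.
move=> y0; rewrite lt_neqAle sumr_ge0 => [|p _]; last exact: roll_ge0.
rewrite andbT eq_sym; apply: contra y0 => /eqP /psumr_eq0P H.
rewrite -[y](rollK k_ge2) (_ : roll k y = 0) ?unroll0 //.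
apply: entry_eq => p; rewrite H ?[RHS]mxE // => q _; exact: roll_ge0.
Qed.

Local Open Scope classical_set_scope.

Lemma continuous_unroll j (x : M) : {for x, continuous (fun t => unroll (k := k) t 0 j)}.
Proof.
have colc i s : {for x, continuous (fun t => col_at t i s)} by apply: coord_continuous.
have planec (f g : 'Z_k -> R) i : {for x, continuous (fun t =>
    \sum_s (col_at t i s * f s + col_at t i.+1 s * g s))}.
  apply: continuous_sum => s.
  apply: (@continuousD _ _ _ (fun t => col_at t i s * f s)).
    apply: (@continuousM _ _ (fun t => col_at t i s) (fun=> f s)) => //; exact: cst_continuous.
  apply: (@continuousM _ _ (fun t => col_at t i.+1 s) (fun=> g s)) => //; exact: cst_continuous.
have -> : (fun t => unroll t 0 j) = (fun t : M => if odd j then plane_y t j.-1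
    else if (j < n)%N then plane_x t j else t (1%g : 'Z_k) j - t (gen k) j).
  by apply/funext => t; rewrite mxE.
case: (odd j); first exact: planec.
case: (j < n)%N; first exact: planec.
apply: (@continuousB _ _ _ (fun t : M => t (1%g : 'Z_k) j)); exact: coord_continuous.
Qed.

Lemma continuous_hat p (f g : V -> R) y : {for y, continuous f} -> {for y, continuous g} ->
  {for y, continuous (fun t => hat k p (f t) (g t))}.
Proof.
move=> fc gc.
have crossc z : {for y, continuous (fun t => cross k z (f t) (g t))}.
  apply: (@continuousB _ _ _ (fun t => cos_dir R k z * g t)).
    by apply: (@continuousM _ _ (fun=> cos_dir R k z)) => //; exact: cst_continuous.
  by apply: (@continuousM _ _ (fun=> sin_dir R k z)) => //; exact: cst_continuous.
rewrite /hat; apply: (@continuousM _ _ _ (fun=> (sin_dir R k 1)^-1)); last exact: cst_continuous.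
apply: (@continuous_max _ _ (fun=> 0)); first exact: cst_continuous.
apply: (@continuous_min _ _ (fun t => cross k (p%:Z - 1) (f t) (g t))) => //.
exact: (continuousN (crossc _)).
Qed.

Lemma continuous_roll s j y : {for y, continuous (fun t : V => roll k t s j)}.
Proof.
have co i : {for y, continuous (fun t : V => t 0 i)} by apply: coord_continuous.
have -> : (fun t => roll k t s j) = (fun t : V =>
    if odd j then hat k s.*2.+1 (t 0 (inord j.-1)) (t 0 j)
    else if (j < n)%N then hat k s.*2 (t 0 j) (t 0 (inord j.+1))
    else if s == 1%g :> 'Z_k then Num.max 0 (t 0 j)
    else if s == gen k :> 'Z_k then Num.max 0 (- t 0 j) else 0).
  by apply/funext => t; rewrite mxE.
case: (odd j); first exact: continuous_hat.
case: (j < n)%N; first exact: continuous_hat.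
case: (s == 1%g).
  by apply: (@continuous_max _ _ (fun=> 0)) => //; exact: cst_continuous.
case: (s == gen k); last exact: cst_continuous.
apply: (@continuous_max _ _ (fun=> 0)); first exact: cst_continuous.
exact: (continuousN (co j)).
Qed.

Definition model_sphere : set M := [set x | model_cone x /\ mass x = 1].

(** As [unroll] is homogeneous and bijective from the cone to the Euclidean space,
  it induces a bijection between rays, that is from the matrices of mass one
  to the vectors of norm one.  Since [roll] is an explicit continuous inverse,
  no compactness argument is needed. *)
Lemma model_sphere_homeomorphic : homeomorphic model_sphere (sphere R n).
Proof.
have unroll_neq0 x : model_sphere x -> unroll (k := k) x != 0.
  case=> xc x1; apply/eqP => ux; have := oner_neq0 R; rewrite -x1 -(unrollK k_ge2 xc) ux roll0.
  by rewrite /mass big1 ?eqxx // => p _; rewrite /entry mxE.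
have sphere_neq0 y : sphere R n y -> y != 0.
  move/sphereE => y1; apply/eqP => y0; have := oner_neq0 R.
  by rewrite -y1 y0 -(scale0r (0 : V)) norm2Z // mul0r eqxx.
exists (fun x => (norm2 (unroll (k := k) x))^-1 *: unroll (k := k) x).
exists (fun y => (mass (roll k y))^-1 *: roll k y).
split=> [||x xS|y yS].
- apply: continuous_in_subspaceT => x; rewrite inE => xS.
  have nx := norm2_gt0 (unroll_neq0 _ xS).
  apply: continuous_matrix => i j; rewrite ord1.
  have -> : (fun t => ((norm2 (unroll (k := k) t))^-1 *: unroll t) 0 j) =
            (fun t : M => (norm2 (unroll (k := k) t))^-1 * unroll t 0 j).
    by apply/funext => t; rewrite mxE.
  apply: (@continuousM _ _ (fun t : M => (norm2 (unroll (k := k) t))^-1)); last exact: continuous_unroll.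
  apply: continuousV; first by rewrite gt_eqF.
  apply: (@continuous_comp _ _ _ (fun t : M => \sum_i unroll (k := k) t 0 i ^+ 2) Num.sqrt).
    apply: continuous_sum => l.
    by apply: (@continuousM _ _ (fun t : M => unroll (k := k) t 0 l)); apply: continuous_unroll.
  exact: sqrt_continuous.
- apply: continuous_in_subspaceT => y; rewrite inE => yS.
  have my := mass_gt0 (sphere_neq0 _ yS).
  apply: continuous_matrix => s j.
  have -> : (fun t => ((mass (roll k t))^-1 *: roll k t) s j) =
            (fun t : V => (mass (roll k t))^-1 * roll k t s j).
    by apply/funext => t; rewrite mxE.
  apply: (@continuousM _ _ (fun t : V => (mass (roll k t))^-1)); last exact: continuous_roll.
  apply: continuousV; first by rewrite gt_eqF.
  by apply: continuous_sum => p; apply: continuous_roll.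
- have nx := norm2_gt0 (unroll_neq0 _ xS); have [xc x1] := xS; split.
    by apply/sphereE; rewrite norm2Z ?invr_ge0 ?ltW // mulVf ?gt_eqF.
  rewrite -unrollZ unrollK //; last by apply: model_coneZ; rewrite ?invr_ge0 ?ltW.
  by rewrite massZ x1 mulr1 invrK scalerA mulfV ?scale1r ?gt_eqF.
have my := mass_gt0 (sphere_neq0 _ yS); split.
  split.
    by apply: model_coneZ; rewrite ?invr_ge0 ?(ltW my) //; apply: roll_model_cone.
  by rewrite massZ mulVf ?gt_eqF.
rewrite unrollZ rollK // norm2Z ?invr_ge0 ?ltW // (iffLR (sphereE y) yS) mulr1 invrK.
by rewrite scalerA mulfV ?scale1r ?gt_eqF.
Qed.

End Homeomorphism.

(** * The sphere in the subdivision *)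

Section SphereSubcomplex.
Variables (R : realType) (k n : nat) (X : equivariant_subdivision R k n.+1).
Hypothesis k_ge2 : (2 <= k)%N.
Notation J := ('Z_k * 'I_n.+1)%type.
Notation V := (vert X).

(** The simplices of [X] over the join of cycles; as [compatible] is a condition on
  pairs, it can be tested on the supports of pairs of vertices. *)
Definition sphere_complex : {set {set V}} :=
  [set A in simp X | [forall u in A, forall v in A, forall p : J, forall q : J,
     (entry (pos u) p != 0) ==> (entry (pos v) q != 0) ==> (compatible p q && tip p)]].

Lemma sphere_complexP (A : {set V}) : reflect
  (A \in simp X /\ forall u v (p q : J), u \in A -> v \in A ->
     entry (pos u) p != 0 -> entry (pos v) q != 0 -> compatible p q && tip p)
  (A \in sphere_complex).
Proof.
rewrite inE; apply: (iffP andP) => -[AX H]; split=> //.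
  move=> u v p q uA vA up vq; move/forall_inP/(_ _ uA)/forall_inP/(_ _ vA): H.
  by move=> /forallP/(_ p)/forallP/(_ q)/implyP/(_ up)/implyP/(_ vq).
apply/forall_inP => u uA; apply/forall_inP => v vA; apply/forallP => p; apply/forallP => q.
by apply/implyP => up; apply/implyP => vq; apply: H up vq.
Qed.

Lemma sphere_subcomplex : subcomplex sphere_complex (simp X).
Proof.
have [n0 closed] := simp_complex X; split; last first.
  by apply/fintype.subsetP => A /sphere_complexP[].
split=> [|A B /sphere_complexP[AX H] BA B0]; first by apply/sphere_complexP => -[AX _]; case/negP: n0.
apply/sphere_complexP; split; first exact: closed BA B0.
by move=> u v p q /(fintype.subsetP BA) uA /(fintype.subsetP BA) vA; apply: H.
Qed.

(** The carrier in [X] of a point of the join of cycles lies over the support of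
  this point, hence belongs to the subcomplex. *)
Lemma polyhedron_sphere_complex :
  polyhedron (@pos _ _ _ X) sphere_complex = @model_sphere R k n.
Proof.
apply/seteqP; split=> x.
  case=> A /sphere_complexP[AX H] [w [w0 w1 ->]].
  have supp p : entry (\sum_(v in A) w v *: pos v) p != 0 ->
      exists2 v, v \in A & entry (pos v) p != 0.
    rewrite entry_sum => nz; apply/exists_inP; apply: contraR nz.
    rewrite negb_exists_in => /forall_inP H0; rewrite big1 // => v vA.
    by have := H0 v vA; rewrite negbK => /eqP->; rewrite mulr0.
  split; last by rewrite /mass sum_entry_sum.
  split=> [p|p q /supp[u uA up] /supp[v vA vq]]; last exact: H up vq.
  by rewrite entry_sum; apply: sumr_ge0 => v vA; rewrite mulr_ge0 ?w0 ?entry_pos_ge0.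
case=> -[x0 xc] x1; pose B : {set J} := [set p | entry x p != 0]%SET.
have BK : B \in join_complex k n.+1.
  rewrite inE; apply/andP; split.
    apply/set0Pn; apply/existsP; apply: contraT; rewrite negb_exists => /forallP B0.
    have := oner_neq0 R; rewrite -x1 /mass big1 ?eqxx // => p _.
    by have := B0 p; rewrite inE negbK => /eqP.
  apply/forall_inP => p; rewrite inE => xp; apply/forall_inP => q; rewrite inE => xq.
  apply/implyP => eq2; have /andP[/andP[/implyP/(_ eq2)/eqP eq1 _] _] := xc p q xp xq.
  by rewrite [p]surjective_pairing [q]surjective_pairing eq1 (eqP eq2).
have [|A [a [AX a0 aE]]] := carrier X BK x0 x1; first by move=> p; rewrite inE.
exists A; last first.
  exists a; split=> //; first by move=> v /a0/ltW.
  by rewrite -(sum_entry_sum (X := X) (mem A) a id) -aE.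
apply/sphere_complexP; split=> // u v p q uA vA up vq.
by apply: xc; rewrite aE; [apply: (carrier_support a0 uA) | apply: (carrier_support a0 vA)].
Qed.

Lemma model_simplex_tip (S : seq J) p : model_simplex n S -> p \in S -> tip p.
Proof.
move=> [lev hd comp] pS; rewrite /tip; apply/implyP => /andP[/eqP pn _].
have hS : head (apex k n n) S \in S /\ ((head (apex k n n) S).2 = n :> nat).
  by case: (S) lev => [|q S']; rewrite rev_iotaS // => -[qn _]; rewrite mem_head.
have [hSin hn] := hS.
have /andP[/implyP H _] := comp _ _ pS hSin.
have /H/eqP-> : p.2 == (head (apex k n n) S).2 by rewrite -val_eqE /= pn hn.
by rewrite hd eqxx.
Qed.

Lemma sphere_chain_in_subcomplex : in_chains sphere_complex (sphere_chain X n).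
Proof.
apply: sphere_chainP => // S t okS tX /allP tS; apply/sphere_complexP; split=> //.
move=> u v p q; rewrite !inE => /tS/supportedP uS /tS/supportedP vS /uS pS /vS qS.
by have [_ _ comp] := okS; rewrite comp // (model_simplex_tip okS).
Qed.

End SphereSubcomplex.

Theorem corollary5p8 (R : realType) (k d : nat) (k_ge2 : (2 <= k)%N)
    (X : equivariant_subdivision R k d.+2) :
  exists (Y : {set {set vert X}}) (x : forall i : nat, chain (vert X) i),
    [/\ subcomplex Y (simp X),
        homeomorphic (polyhedron (@pos _ _ _ X) Y) (sphere R d.+1),
        generalized_sphere d.+1 x,
        in_chains Y (x d.+1) &
        forall l : vert X -> 'Z_k * nat,
          positive_colors l -> admissible l -> equivariant l ->
          (alpha l (x d.+1) = 1 %[mod k%:Z])%Z].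
Proof.
exists (sphere_complex X), (sphere_chain X); split.
- exact: sphere_subcomplex.
- by rewrite polyhedron_sphere_complex; apply: model_sphere_homeomorphic.
- exact: sphere_chain_generalized.
- exact: sphere_chain_in_subcomplex.
move=> l _ adm eqv.
apply: (alpha_generalized_sphere k_ge2 adm eqv (sphere_chain_generalized X k_ge2)).
by rewrite augmentation_sphere_chain0.
Qed.
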